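(* Let $K$ be a number field containing a primitive cube root of unity $\zeta_3$, and let $E/K$ be an elliptic curve with complex multiplication by $\mathbb{Z}[\zeta_3]$. Then there exist infinitely many linearly disjoint (over $K$) $C_3$-extensions $L_1,L_2,\ldots$ of $K$ such that $\mathrm{rank}\,E(L_i)\ge\mathrm{rank}\,E(K)+2$ for all $i$.
   Context: A $C_3$-extension of $K$ is a Galois extension $L/K$ with $\mathrm{Gal}(L/K)$ cyclic of order $3$. $\mathrm{rank}\,E(L)$ is the rank of the Mordell–Weil group $E(L)$. *)

(* Defs.v *)
From HB Require Import structures.
From mathcomp Require Import all_boot all_order all_algebra all_fingroup.
From mathcomp Require Import all_solvable all_field.
From mathcomp Require Import mpoly.
From mathcomp Require Import boolp constructive_ereal.
From mathcomp Require Import ring.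

Set Implicit Arguments.
Unset Strict Implicit.
Unset Printing Implicit Defensive.

Import GRing.Theory.
Local Open Scope ring_scope.

(* y^2 + a1 x y + a3 y = x^3 + a2 x^2 + a4 x + a6 *)
Record weierstrass (F : Type) := Weierstrass {
  wa1 : F; wa2 : F; wa3 : F; wa4 : F; wa6 : F }.

Definition base_change (F F' : Type) (f : F -> F') (E : weierstrass F) :=
  Weierstrass (f (wa1 E)) (f (wa2 E)) (f (wa3 E)) (f (wa4 E)) (f (wa6 E)).

Definition discriminant (R : pzRingType) (E : weierstrass R) : R :=
  let: Weierstrass a1 a2 a3 a4 a6 := E in
  let b2 := a1 ^+ 2 + 4%:R * a2 in
  let b4 := 2%:R * a4 + a1 * a3 in
  let b6 := a3 ^+ 2 + 4%:R * a6 in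
  let b8 := a1 ^+ 2 * a6 + 4%:R * a2 * a6 - a1 * a3 * a4 + a2 * a3 ^+ 2
            - a4 ^+ 2 in
  - b2 ^+ 2 * b8 - 8%:R * b4 ^+ 3 - 27%:R * b6 ^+ 2 + 9%:R * b2 * b4 * b6.

Definition elliptic (R : pzRingType) (E : weierstrass R) : Prop :=
  discriminant E != 0.

Section Points.

Variables (F : fieldType) (E : weierstrass F).

Local Notation a1 := (wa1 E).
Local Notation a2 := (wa2 E).
Local Notation a3 := (wa3 E).
Local Notation a4 := (wa4 E).
Local Notation a6 := (wa6 E).

(* [None] is the point at infinity [0 : 1 : 0]. *)
Definition on_curve (P : option (F * F)) : bool :=
  if P is Some (x, y) then
    y ^+ 2 + a1 * x * y + a3 * y == x ^+ 3 + a2 * x ^+ 2 + a4 * x + a6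
  else true.

Definition ecpoint : Type := {P : option (F * F) | on_curve P}.

Definition opp_raw (P : option (F * F)) : option (F * F) :=
  if P is Some (x, y) then Some (x, - y - a1 * x - a3) else None.

(* Tangent slope when the abscissas agree: it is only used when the two points
   are not opposite, hence equal. *)
Definition slope (x1 y1 x2 y2 : F) : F :=
  if x1 == x2 then
    (3%:R * x1 ^+ 2 + 2%:R * a2 * x1 + a4 - a1 * y1)
      / (2%:R * y1 + a1 * x1 + a3)
  else (y2 - y1) / (x2 - x1).

Definition add_raw (P Q : option (F * F)) : option (F * F) :=
  match P, Q with
  | None, _ => Q
  | _, None => P
  | Some (x1, y1), Some (x2, y2) =>
    if (x1 == x2) && (y2 == - y1 - a1 * x1 - a3) then None else
    let l := slope x1 y1 x2 y2 in
    let x3 := l ^+ 2 + a1 * l - a2 - x1 - x2 in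
    Some (x3, - (l * (x3 - x1) + y1) - a1 * x3 - a3)
  end.

Fact opp_subproof (P : ecpoint) : on_curve (opp_raw (val P)).
Proof.
case: P => [[[x y]|]] //= /eqP e; apply/eqP; rewrite -{}e; ring.
Qed.

Fact add_subproof (P Q : ecpoint) : on_curve (add_raw (val P) (val Q)).
Proof.
case: P Q => [[[x1 y1]|] /= e1] [[[x2 y2]|] /= e2] //=.
case: ifPn => // nopp.
set l := slope x1 y1 x2 y2.
pose w x y := x ^+ 3 + a2 * x ^+ 2 + a4 * x + a6
  - (y ^+ 2 + a1 * x * y + a3 * y).
have w1 : w x1 y1 = 0 by rewrite /w (eqP e1) subrr.
have w2 : w x2 y2 = 0 by rewrite /w (eqP e2) subrr.
pose g := (x1 ^+ 2 + x1 * x2 + x2 ^+ 2) + a2 * (x1 + x2) + a4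
         - l * (2%:R * y1 + l * (x2 - x1)) - a1 * (y1 + l * x2) - a3 * l.
have g0 : g = 0.
  rewrite /g /l /slope; case: eqP nopp => [ex /= ny | /eqP ne _].
    rewrite -{}ex in w2 *.
    have yy : y2 = y1.
      apply/eqP; rewrite -subr_eq0; move: ny; rewrite -subr_eq0 => /mulIf ny.
      apply/eqP/ny; rewrite mul0r -[RHS](subrr 0) -{1}w1 -w2 /w; ring.
    have d0 : 2%:R * y1 + a1 * x1 + a3 != 0.
      by apply: contraNneq ny => d0; rewrite yy -subr_eq0 -d0; apply/eqP; ring.
    by field.
  have d0 : x2 - x1 != 0 by rewrite subr_eq0 eq_sym.
  apply: (mulIf d0); rewrite mul0r -[RHS](subrr 0) -{1}w2 -w1 /w.
  by field.
rewrite /=; set x3 := l ^+ 2 + _ - _ - _ - _; rewrite eq_sym -subr_eq0; apply/eqP.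
transitivity (w x1 y1 + (x3 - x1) * g); last by rewrite w1 g0 mulr0 addr0.
by rewrite /w /g /x3; ring.
Qed.

Definition ec0 : ecpoint := exist on_curve None isT.
Definition ec_opp (P : ecpoint) : ecpoint := exist on_curve _ (opp_subproof P).
Definition ec_add (P Q : ecpoint) : ecpoint :=
  exist on_curve _ (add_subproof P Q).

Definition ec_mulz (P : ecpoint) (m : int) : ecpoint :=
  match m with
  | Posz n => iter n (ec_add P) ec0
  | Negz n => iter n.+1 (ec_add (ec_opp P)) ec0
  end.

Definition z_independent (n : nat) (P : 'I_n -> ecpoint) : Prop :=
  forall c : 'I_n -> int,
    \big[ec_add/ec0]_(i < n) ec_mulz (P i) (c i) = ec0 -> forall i, c i = 0.

Definition has_independent (n : nat) : Prop :=
  exists P : 'I_n -> ecpoint, z_independent P.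

(* The maximal number of Z-independent points, [+oo] if there is no maximum:
   it makes sense without appealing to the Mordell-Weil theorem. *)
Definition ec_rank : \bar int :=
  match pselect (exists r : nat, forall n, has_independent n <-> (n <= r)%N) with
  | left h => (Posz (sval (cid h)))%:E
  | right _ => +oo%E
  end.

Lemma has_independentS n : has_independent n.+1 -> has_independent n.
Proof.
case=> P indP; exists (fun i => P (lift ord0 i)) => c c0 i.
pose d j := if unlift ord0 j is Some k then c k else 0.
have add0 Q : ec_add ec0 Q = Q by apply/val_inj.
have dL k : d (lift ord0 k) = c k by rewrite /d liftK.
rewrite -dL; apply: indP; rewrite big_ord_recl {1}/d unlift_none /= add0.
by rewrite -[RHS]c0; apply: eq_bigr => k _; rewrite dL.
Qed.

Lemma ec_rank_geP n : (n%:Z%:E <= ec_rank)%E <-> has_independent n.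
Proof.
have indW m k : (m <= k)%N -> has_independent k -> has_independent m.
  by move=> /subnK <-; elim: (k - m)%N => // j IH /has_independentS.
rewrite /ec_rank; case: pselect => [h | nor].
  by case: (cid h) => r /= hr; rewrite hr lee_fin.
rewrite leey; split=> // _; apply: contrapT => nind.
have [r [indr nindr]] : exists r, has_independent r /\ ~ has_independent r.+1.
  apply: contrapT => nr; apply: nind; elim: n => [|m indm].
    by exists (fun=> ec0) => c _ [].
  by apply: contrapT => ?; apply: nr; exists m.
apply: nor; exists r => m; split=> [indm | /indW]; last exact.
by rewrite leqNgt; apply/negP => /indW /(_ indm).
Qed.

Definition homogeneous_coord (P : ecpoint) : 'I_3 -> F :=
  fun i => if val P is Some (x, y) then [:: x; y; 1]`_i else [:: 0; 1; 0]`_i.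

(* Over an algebraically closed field, a morphism of projective curves E -> E:
   around each point it is given by forms of a common degree that do not all
   vanish there. *)
Definition is_morphism (phi : ecpoint -> ecpoint) : Prop :=
  forall P : ecpoint, exists (d : nat) (f : 'I_3 -> {mpoly F[3]}),
    [/\ forall i, f i \is d.-homog,
        exists i, (f i).@[homogeneous_coord P] != 0 &
        forall Q : ecpoint, (exists i, (f i).@[homogeneous_coord Q] != 0) ->
          exists2 c : F, c != 0 &
            forall i, (f i).@[homogeneous_coord Q]
                      = c * homogeneous_coord (phi Q) i].

Definition is_endomorphism (phi : ecpoint -> ecpoint) : Prop :=
  is_morphism phi /\ phi ec0 = ec0.

(* [theta] is a ring isomorphism from the subring [O] onto End(E), whose
   addition is pointwise and whose multiplication is composition. Its values
   outside [O] are irrelevant. *)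
Definition has_CM_by (R : pzRingType) (O : R -> Prop) : Prop :=
  exists theta : R -> ecpoint -> ecpoint,
    [/\ forall x, O x -> is_endomorphism (theta x),
        forall phi, is_endomorphism phi -> exists2 x, O x & phi =1 theta x,
        forall x y, O x -> O y -> theta x =1 theta y -> x = y,
        theta 1 =1 id &
        forall x y, O x -> O y ->
          (forall P, theta (x + y) P = ec_add (theta x P) (theta y P)) /\
          (forall P, theta (x * y) P = theta x (theta y P))].

End Points.

Definition Z_adjoin (R : nzRingType) (z : R) (x : R) : Prop :=
  exists p : {poly int}, x = (map_poly intr p).[z].

Section LinearDisjointness.

Variable Omega : fieldType.

Definition independent_over (k : Omega -> Prop) (m : nat) (v : 'I_m -> Omega) :=
  forall c : 'I_m -> Omega, (forall i, k (c i)) ->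
    \sum_(i < m) c i * v i = 0 -> forall i, c i = 0.

Definition linearly_disjoint (k A B : Omega -> Prop) : Prop :=
  forall (m : nat) (v : 'I_m -> Omega), (forall i, A (v i)) ->
    independent_over k v -> independent_over B v.

(* The subfield of [Omega] generated by [k], [A 0], ..., [A n.-1]. *)
Definition compositum (k : Omega -> Prop) (A : nat -> Omega -> Prop) (n : nat)
    (z : Omega) : Prop :=
  forall S : {pred Omega}, divring_closed S ->
    (forall x, k x -> x \in S) ->
    (forall j x, (j < n)%N -> A j x -> x \in S) -> z \in S.

Definition linearly_disjoint_seq (k : Omega -> Prop)
    (A : nat -> Omega -> Prop) : Prop :=
  forall n, linearly_disjoint k (A n) (compositum k A n).

End LinearDisjointness.

Definition image_of (T U : Type) (f : T -> U) (z : U) : Prop :=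
  exists x, z = f x.

Definition is_C3_extension (K : fieldType) (L : splittingFieldType K) : Prop :=
  [/\ galois 1 {:L}, cyclic 'Gal({:L} / 1)%g & #|'Gal({:L} / 1)%g| = 3%N].

(* Main.v *)
(** Complex multiplication by Z[zeta_3] forces c4(E) = 0: the endomorphism zeta
    acts on abscissas by an affine map of order 3 that permutes the nonzero
    2-torsion points without fixed point.  So E can be brought, over K, into the
    form y^2 = x^3 + D, with D moreover replaced at will by D u^6.

    For y0 in K put a = y0^2 - D, L = K(a^(1/3)) and P = (a^(1/3), y0) in E(L).
    The points of Z[zeta] P have the shape (a^(1/3) c, d) with c, d in K, so those
    in E(K) have abscissa 0 and are killed by 3; hence if P is not torsion the
    rank of E(L) exceeds that of E(K) by at least 2.  Taking y0 = t + 2^(-k) with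
    t in Z and k large makes P non-torsion, because doubling then divides the
    ordinate by 8 up to a 2-adic unit.

    If u is chosen so that D generates K over Q, the norm of a is the value at t of
    a separable polynomial, and therefore is divisible exactly once by arbitrarily
    large primes.  This yields successive values of t for which the classes of a
    in K^*/K^*^3 are independent, and Kummer theory gives linear disjointness.

    Associativity of the group law is a computation for points in general position;
    the general case follows by adding a generic point to both sides. *)

Require Import Defs.
From HB Require Import structures.
From mathcomp Require Import all_boot all_order all_algebra all_fingroup.
From mathcomp Require Import all_solvable all_field.
From mathcomp Require Import mpoly boolp constructive_ereal ring.

Set Implicit Arguments.
Unset Strict Implicit.
Unset Printing Implicit Defensive.

Import Order.TTheory GRing.Theory Num.Theory.
Local Open Scope ring_scope.

(** * The group law on y^2 = x^3 + D *)

(** Points over K and over all the fields L are compared inside one group, [mpoint D0] over the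
    algebraic numbers. The map [point_map] is injective and additive on each E(F), so independence
    is tested there, and associativity is wanted only for y^2 = x^3 + D over a closed field. Once c4
    = 0, the action of zeta is the explicit map (x, y) -> (zeta x, y), called [rotate]. Finiteness
    of the rank is not assumed, so the rank bound is proved by turning n independent points into n +
    2.

    The freedom in u serves the norm argument: the norm of (t + s)^2 - D is the characteristic
    polynomial of multiplication by D evaluated at (t + s)^2. If D lay in a proper subfield this
    polynomial would be a proper power, and no prime could divide its values exactly once. *)

Definition mordell (F : nzRingType) (D : F) : weierstrass F :=
  Weierstrass 0 0 0 0 D.

Section MordellGroup.

Variables (F : numClosedFieldType) (D : F).

Local Notation E := (mordell D).
Local Notation pt := (ecpoint E).
Implicit Types x y l m n : F.

Lemma on_mordellE x y : on_curve E (Some (x, y)) = (y ^+ 2 == x ^+ 3 + D).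
Proof. by rewrite /= !mul0r !addr0. Qed.

(* The three points of the line through [(x1, y1)] of slope [l] have abscissas
   [x1], [x2] and [l ^+ 2 - x1 - x2]; chords and tangents are both covered. *)
Definition on_line x1 y1 x2 l : Prop := forall x,
  x ^+ 3 + D - (y1 + l * (x - x1)) ^+ 2
  = (x - x1) * (x - x2) * (x - (l ^+ 2 - x1 - x2)).

Definition third x1 y1 x2 l : option (F * F) :=
  Some (l ^+ 2 - x1 - x2, - (y1 + l * (l ^+ 2 - x1 - x2 - x1))).

(** Hides the formula for the slope: what later proofs need is the factorisation [on_line], and
    conversely, by [add_lineE], any [l] with this property computes the sum. *)
Variant add_spec x1 y1 x2 y2 : option (F * F) -> Prop :=
 | AddOpp of x1 = x2 & y2 = - y1 : add_spec x1 y1 x2 y2 None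
 | AddLine l of (x1 = x2 -> y1 = y2 /\ y1 != 0) & y2 = y1 + l * (x2 - x1)
     & on_line x1 y1 x2 l : add_spec x1 y1 x2 y2 (third x1 y1 x2 l).

Lemma on_lineP x1 y1 x2 y2 l : y1 ^+ 2 = x1 ^+ 3 + D -> y2 ^+ 2 = x2 ^+ 3 + D ->
  y2 = y1 + l * (x2 - x1) -> (x1 = x2 -> l * (2%:R * y1) = 3%:R * x1 ^+ 2) ->
  on_line x1 y1 x2 l.
Proof.
move=> c1 c2 yl tl x.
(* The two sides differ by a polynomial of degree at most 1 in [x] that vanishes at [x1], and [e] is
   its leading coefficient. It is 0 by the second point for a chord, by the slope condition for a
   tangent. *)
pose e := x1 ^+ 2 + x1 * x2 + x2 ^+ 2 - 2%:R * y1 * l - l ^+ 2 * (x2 - x1).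
have e0 : e = 0.
  have [ex|nex] := eqVneq x1 x2.
    rewrite /e -ex subrr mulr0 subr0.
    transitivity (3%:R * x1 ^+ 2 - l * (2%:R * y1)); first by ring.
    by rewrite tl // subrr.
  have : (x2 - x1) * e = 0.
    transitivity ((x2 ^+ 3 + D) - (x1 ^+ 3 + D) + y1 ^+ 2 - (y1 + l * (x2 - x1)) ^+ 2).
      by rewrite /e; ring.
    by rewrite -c2 -c1 -yl; ring.
  by move/eqP; rewrite mulf_eq0 subr_eq0 eq_sym (negPf nex) => /eqP.
transitivity ((x - x1) * (x - x2) * (x - (l ^+ 2 - x1 - x2)) + (x1 ^+ 3 + D) - y1 ^+
  2 + (x - x1) * e).
  by rewrite /e; ring.
by rewrite e0 c1; ring.
Qed.

(** Equates the derivatives at [x1] of the two sides of [on_line]. *)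
Lemma on_line_tangent x1 y1 x2 l : y1 ^+ 2 = x1 ^+ 3 + D -> on_line x1 y1 x2 l ->
  3%:R * x1 ^+ 2 - 2%:R * y1 * l = (x1 - x2) * (x1 - (l ^+ 2 - x1 - x2)).
Proof.
move=> c1 h; set r := RHS.
transitivity (x1 ^+ 3 + D - y1 ^+ 2 + (3%:R * x1 ^+ 2 - 2%:R * y1 * l)).
  by rewrite c1; ring.
(* The linear coefficient around [x1] is read off from the value at [x1 + 1], where the terms of
   degree 2 and 3 contribute 3 x1 - l^2 and 1. *)
transitivity ((x1 + 1) ^+ 3 + D - (y1 + l * (x1 + 1 - x1)) ^+ 2
              - (1 + 3%:R * x1 - l ^+ 2)); first by ring.
by rewrite h /r; ring.
Qed.

Lemma addP x1 y1 x2 y2 : y1 ^+ 2 = x1 ^+ 3 + D -> y2 ^+ 2 = x2 ^+ 3 + D ->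
  add_spec x1 y1 x2 y2 (add_raw E (Some (x1, y1)) (Some (x2, y2))).
Proof.
move=> c1 c2; rewrite /=.
set l := slope E _ _ _ _.
have -> : l ^+ 2 + 0 * l - 0 - x1 - x2 = l ^+ 2 - x1 - x2 by ring.
set x3 := l ^+ 2 - x1 - x2.
have -> : - y1 - 0 * x1 - 0 = - y1 by ring.
have -> : - (l * (x3 - x1) + y1) - 0 * x3 - 0 = - (y1 + l * (x3 - x1)) by ring.
case: ifPn => [/andP[/eqP ? /eqP ?]|nopp]; first by constructor.
have tl : x1 = x2 -> y1 = y2 /\ y1 != 0.
  move=> ex; rewrite ex eqxx /= in nopp.
  have /eqP : y2 ^+ 2 = y1 ^+ 2 by rewrite c1 c2 ex.
  rewrite eqf_sqr (negPf nopp) orbF => /eqP ey; split=> //.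
  by apply: contraNneq nopp => y10; rewrite ey y10 oppr0.
have yl : y2 = y1 + l * (x2 - x1).
  rewrite /l /slope; case: eqVneq => [ex | nex].
    by rewrite ex subrr mulr0 addr0; case: (tl ex).
  by rewrite divfK ?subr_eq0 1?eq_sym //; ring.
apply: AddLine => //; apply: on_lineP c1 c2 yl _ => ex.
have [_ y10] := tl ex; rewrite /l /slope ex eqxx /=.
rewrite mul0r !mulr0 !mul0r !addr0 subr0 divfK // mulf_neq0 // pnatr_eq0 //.
Qed.

Lemma add_lineE x1 y1 x2 y2 l : y1 ^+ 2 = x1 ^+ 3 + D -> y2 ^+ 2 = x2 ^+ 3 + D ->
  (x1 = x2 -> y2 != - y1) -> y2 = y1 + l * (x2 - x1) -> on_line x1 y1 x2 l ->
  add_raw E (Some (x1, y1)) (Some (x2, y2)) = third x1 y1 x2 l.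
Proof.
move=> c1 c2 nopp yl ol; case: (addP c1 c2) => [ex ey | m tl ym om].
  by have := nopp ex; rewrite ey eqxx.
suff -> : m = l by [].
have [ex|nex] := eqVneq x1 x2.
  have [_ y10] := tl ex.
  have := on_line_tangent c1 ol; have := on_line_tangent c1 om.
  rewrite -!ex !subrr !mul0r => /subr0_eq -> /subr0_eq /mulfI -> //.
  by rewrite mulf_neq0 // pnatr_eq0.
have : m * (x2 - x1) = l * (x2 - x1) by apply: (addrI y1); rewrite -ym.
by move/mulIf; apply; rewrite subr_eq0 eq_sym.
Qed.

Lemma third_on x1 y1 x2 l : on_line x1 y1 x2 l ->
  (- (y1 + l * (l ^+ 2 - x1 - x2 - x1))) ^+ 2 = (l ^+ 2 - x1 - x2) ^+ 3 + D.
Proof. by move/(_ (l ^+ 2 - x1 - x2)); rewrite subrr mulr0 sqrrN => /subr0_eq. Qed.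

Lemma ptP (P : pt) : P = ec0 E \/ exists x y (h : y ^+ 2 = x ^+ 3 + D),
   val P = Some (x, y).
Proof.
case: P => [[[x y]|] h]; last by left; apply: val_inj.
by right; exists x, y; split=> //; move: h; rewrite on_mordellE => /eqP.
Qed.

Lemma val_ec_add (P Q : pt) : val (ec_add P Q) = add_raw E (val P) (val Q).
Proof. by []. Qed.

Lemma val_ec_opp (P : pt) : val (ec_opp P) = opp_raw E (val P).
Proof. by []. Qed.

Lemma ec_add0 (P : pt) : ec_add (ec0 E) P = P.
Proof. exact: val_inj. Qed.

Lemma ec_addN (P : pt) : ec_add (ec_opp P) P = ec0 E.
Proof.
apply: val_inj; rewrite val_ec_add val_ec_opp.
case: (ptP P) => [-> //|[x [y [h ->]]]] /=.
by rewrite eqxx /= (_ : _ == _) //; apply/eqP; ring.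
Qed.

Lemma ec_oppK (P : pt) : ec_opp (ec_opp P) = P.
Proof.
apply: val_inj; rewrite !val_ec_opp; case: (ptP P) => [-> //|[x [y [h ->]]]] /=.
by congr (Some (_, _)); ring.
Qed.

Lemma opp_rawE x y : opp_raw E (Some (x, y)) = Some (x, - y).
Proof. by rewrite /=; congr (Some (_, _)); ring. Qed.

Lemma ec_addC (P Q : pt) : ec_add P Q = ec_add Q P.
Proof.
apply: val_inj; rewrite !val_ec_add.
case: (ptP P) => [->|[x [y [h ->]]]]; first by case: (val Q) => [[]|].
case: (ptP Q) => [->|[x' [y' [h' ->]]]] //.
case: (addP h h') => [-> ->|l tl yl ol].
  by rewrite /= eqxx /= mul0r !subr0 opprK eqxx.
rewrite (@add_lineE x' y' x y l) //.
- by rewrite /third; congr (Some (_, _)); rewrite ?yl; ring.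
- move=> ex; have [<- y0] := tl (esym ex).
  by rewrite -addr_eq0 -mulr2n -mulr_natl mulf_neq0 // pnatr_eq0.
- by rewrite yl; ring.
- move=> t; rewrite (_ : y' + _ = y + l * (t - x)); last by rewrite yl; ring.
  by rewrite ol; ring.
Qed.

Hypothesis D0 : D != 0.

(** A case of associativity that has to be available before the general one. The line through P + T
    and -T is the mirror image of the line through P and T, so its slope is [- l]. *)
Lemma ec_addK (P T : pt) : ec_add (ec_add P T) (ec_opp T) = P.
Proof.
case: (ptP P) => [->|[x [y [h eP]]]]; first by rewrite ec_add0 ec_addC ec_addN.
apply: val_inj; rewrite !val_ec_add val_ec_opp eP.
case: (ptP T) => [->//|[x' [y' [h' ->]]]].
rewrite opp_rawE; case: (addP h h') => [ex ey|l tl yl ol].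
  by rewrite /= ey opprK ex.
rewrite /third (@add_lineE _ _ _ _ (- l)) ?sqrrN ?(third_on ol) //.
- rewrite /third; congr (Some (_, _)); ring.
- by rewrite -(third_on ol) sqrrN.
(* Here [D != 0] enters: if the line met the curve twice at T with [y'] = 0, the tangent condition
   would force [x'] = 0, hence D = 0. *)
- move=> ex; rewrite opprK ex -yl eq_sym -addr_eq0 -mulr2n.
  rewrite mulrn_eq0 /=; apply: contraNneq D0 => y0.
  have ol' : on_line x' y' x l.
    by move=> t; rewrite yl; have := ol t; rewrite -[RHS]mulrA [(t - x') * _]mulrC; 
       move=> e; transitivity (t ^+ 3 + D - (y + l * (t - x)) ^+ 2);
         [ring | rewrite e; ring].
  have := on_line_tangent h' ol'.
  rewrite y0 mulr0 mul0r subr0 (_ : l ^+ 2 - x' - x = l ^+ 2 - x - x'); last by ring.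
  rewrite ex subrr mulr0 => /eqP; rewrite mulf_eq0 pnatr_eq0 /= expf_eq0 /= => /eqP x0.
  by move: h'; rewrite y0 x0 !expr0n /= add0r => <-.
- by rewrite yl; ring.
- move=> t; transitivity (t ^+ 3 + D - (y + l * (t - x)) ^+ 2); first by ring.
  by rewrite ol; ring.
Qed.

Lemma ec_add_eq (P Q R : pt) : ec_add P Q = R -> P = ec_add R (ec_opp Q).
Proof. by move=> <-; rewrite ec_addK. Qed.

Lemma ec_addI (P : pt) : injective (ec_add P).
Proof. by move=> Q R; rewrite !(ec_addC P) => /ec_add_eq ->; rewrite ec_addK. Qed.

Lemma ec_addKl (P Q : pt) : ec_add (ec_opp P) (ec_add P Q) = Q.
Proof. by rewrite ec_addC (ec_addC P) ec_addK. Qed.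

Lemma neq_abscissa (P Q : pt) x y x' y' : val P = Some (x, y) ->
  val Q = Some (x', y') -> P <> Q -> P <> ec_opp Q -> x != x'.
Proof.
move=> eP eQ PQ PNQ; apply/eqP => ex.
have := valP P; have := valP Q; rewrite eP eQ !on_mordellE => /eqP h' /eqP h.
have /eqP : y ^+ 2 = y' ^+ 2 by rewrite h h' ex.
rewrite eqf_sqr => /orP[] /eqP ey.
  by apply: PQ; apply: val_inj; rewrite eP eQ ex ey.
by apply: PNQ; apply: val_inj; rewrite val_ec_opp eP eQ opp_rawE ex ey.
Qed.

(** The slopes [mu] of (A + B, T) and [nu] of (A, B + T) are rational in the slopes [m] of (A, B)
    and [n] of (B, T): with c = (n - m) / (xT - xA) one has c (mu + m) = 1 = c (nu + n). After this
    substitution both sides agree by a field identity. *)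
Lemma generic_slope_identity xA yA xB yB xT yT m n mu nu :
  yA ^+ 2 = xA ^+ 3 + D -> yB ^+ 2 = xB ^+ 3 + D -> yT ^+ 2 = xT ^+ 3 + D ->
  (xA = xB -> yA = yB) ->
  yB = yA + m * (xB - xA) -> on_line xA yA xB m ->
  yT = yB + n * (xT - xB) -> on_line xB yB xT n ->
  let x3 := m ^+ 2 - xA - xB in let y3 := - (yA + m * (x3 - xA)) in
  let x4 := n ^+ 2 - xB - xT in let y4 := - (yB + n * (x4 - xB)) in
  yT = y3 + mu * (xT - x3) -> y4 = yA + nu * (x4 - xA) ->
  xT != xA -> xT != xB -> xT != x3 -> xA != x4 ->
  third x3 y3 xT mu = third xA yA x4 nu.
Proof.
move=> hA hB hT eAB em om en on_ x3 y3 x4 y4 emu enu TA TB T3 A4.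
pose c := (n - m) / (xT - xA).
have TA0 : xT - xA != 0 by rewrite subr_eq0.
have TB0 : xT - xB != 0 by rewrite subr_eq0.
have T30 : xT - x3 != 0 by rewrite subr_eq0.
have A40 : xA - x4 != 0 by rewrite subr_eq0.
have nm : n = m + c * (xT - xA) by rewrite /c divfK //; ring.
have AT0 : xA - xT != 0 by rewrite subr_eq0 eq_sym.
(* The factorisation for the line AB is evaluated at [xT]. Its left side is a difference of squares,
   with factors c (xT - xA) (xT - xB) and (mu + m) (xT - x3). *)
have cmu : c * (mu + m) = 1.
  have e1 : yT - (yA + m * (xT - xA)) = c * (xT - xA) * (xT - xB).
    by rewrite en em nm; ring.
  have e2 : yT + (yA + m * (xT - xA)) = (mu + m) * (xT - x3).
    by rewrite emu /y3; ring.
  have := om xT; rewrite -hT -/x3 subr_sqr e1 e2 => e.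
  apply: (mulIf T30); apply: (mulIf TB0); apply: (mulIf TA0).
  by rewrite mul1r -[RHS]mulrA [RHS]mulrC [(xT - xB) * _]mulrC -e; ring.
have cnu : c * (nu + n) = 1.
  have e2 : yA + (yB + n * (xA - xB)) = (nu + n) * (xA - x4).
    transitivity (y4 - nu * (x4 - xA) + (yB + n * (xA - xB))).
      by rewrite enu addrK.
    by rewrite /y4; ring.
  (* When A = B the common factor [xA - xB] cannot be cancelled, and the tangent condition at A
     replaces it. *)
  have [ex|nex] := eqVneq xA xB.
    have ey := eAB ex; rewrite -ex in on_ e2 TB0.
    have := on_line_tangent hA om; rewrite -{1}ex subrr mul0r => /subr0_eq tA.
    rewrite -ey in on_ e2; have := on_line_tangent hA on_.
    rewrite tA (_ : n ^+ 2 - xA - xT = x4); last by rewrite /x4 ex.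
    move=> e.
    apply: (mulIf A40); apply: (mulIf AT0); rewrite mul1r [RHS]mulrC -e.
    by rewrite -[c * _ * _]mulrA -e2 subrr mulr0 addr0 nm; ring.
  have e1 : yA - (yB + n * (xA - xB)) = c * (xA - xT) * (xA - xB).
    by rewrite em nm; ring.
  have := on_ xA; rewrite -hA -/x4 subr_sqr e1 e2 => e.
  have AB0 : xA - xB != 0 by rewrite subr_eq0.
  apply: (mulIf A40); apply: (mulIf AB0); apply: (mulIf AT0).
  by rewrite mul1r -[RHS]mulrA [RHS]mulrC -e; ring.
have c0 : c != 0 by apply: contra_eq_neq cmu => ->; rewrite mul0r eq_sym oner_eq0.
have muE : mu = c^-1 - m by rewrite -[mu](mulKf c0) -[c * mu](addrK (c * m)) -mulrDr
  cmu; field.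
have nuE : nu = c^-1 - n by rewrite -[nu](mulKf c0) -[c * nu](addrK (c * n)) -mulrDr
  cnu; field.
have ex : mu ^+ 2 - x3 - xT = nu ^+ 2 - xA - x4.
  by rewrite muE nuE /x3 /x4 nm; field.
rewrite /third ex; congr (Some (_, _)); congr (- _); rewrite -ex.
transitivity (yT + mu * (mu ^+ 2 - x3 - xT - xT)); first by rewrite emu; ring.
by rewrite en em muE nuE /x3 nm; field.
Qed.

(** For T outside this list, the sums B + T, (A + B) + T and A + (B + T) are all given by chords
    between points with distinct abscissas, unless a point at infinity is involved. The sum A + B
    itself may still be a tangent. *)
Definition bad_points (A B : pt) : seq pt :=
  let C := ec_add A B in
  [:: ec0 E; A; ec_opp A; B; ec_opp B; C; ec_opp C;
      ec_add A (ec_opp B); ec_add (ec_opp A) (ec_opp B)].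

Lemma generic_assoc (A B T : pt) : (T \notin bad_points A B) ->
  ec_add (ec_add A B) T = ec_add A (ec_add B T).
Proof.
move=> bad.
case: (ptP A) => [->|[xA [yA [hA eA]]]]; first by rewrite !ec_add0.
case: (ptP B) => [->|[xB [yB [hB eB]]]]; first by rewrite (ec_addC A) !ec_add0.
rewrite /bad_points !inE !negb_or in bad.
case/and5P: bad => /eqP T0 /eqP TA /eqP TNA /eqP TB /and5P[/eqP TNB /eqP TC /eqP TNC
  /eqP TAB /eqP TNAB].
case: (ptP T) T0 => // - [xT [yT [hT eT]]] _.
have xTA := neq_abscissa eT eA TA TNA.
have xTB := neq_abscissa eT eB TB TNB.
have [AB|AB] := eqVneq A (ec_opp B).
  by rewrite AB ec_addKl ec_addN ec_add0.
have BTA : A <> ec_add B T.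
  by move=> e; apply: TAB; rewrite e (ec_addC B) ec_addK.
have BTNA : A <> ec_opp (ec_add B T).
  by move=> e; apply: TNAB; rewrite e ec_oppK (ec_addC B) ec_addK.
case: (ptP (ec_add A B)) => [e|[xC [yC [hC eC]]]].
  by move: AB; rewrite (ec_add_eq e) ec_add0 eqxx.
case: (ptP (ec_add B T)) => [e|[xS [yS [hS eS]]]].
  by case: TNB; rewrite -(ec_addKl B T) e ec_addC ec_add0.
have xTC := neq_abscissa eT eC TC TNC.
have xAS := neq_abscissa eA eS BTA BTNA.
apply: val_inj; rewrite [LHS]val_ec_add [RHS]val_ec_add eC eA eT eS.
move: eC eS; rewrite !val_ec_add eA eB eT.
case: (addP hA hB) => // m tm em om [? ?]; case: (addP hB hT) => // n tn en on_ [? ?].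
subst xC yC xS yS.
case: (addP hC hT) => [e|mu tmu emu omu]; first by rewrite e eqxx in xTC.
case: (addP hA hS) => [e|nu tnu enu onu]; first by rewrite e eqxx in xAS.
by apply: (generic_slope_identity hA hB hT _ em om en on_ emu enu) => // /tm[].
Qed.

Lemma exists_point (s : seq pt) : exists T : pt, T \notin s.
Proof.
pose x (n : nat) : F := 3.-root (n%:R ^+ 2 - D).
have on (n : nat) : on_curve E (Some (x n, n%:R)).
  by rewrite on_mordellE rootCK // subrK.
pose T (n : nat) : pt := exist (on_curve E) _ (on n).
have injT : injective T.
  by move=> i j [_ /eqP]; rewrite eqr_nat => /eqP.
have [/allP h|] := boolP (all (mem s) [seq T i | i <- iota 0 (size s).+1]); last first.
  by case/allPn => P _ Ps; exists P.
have /uniq_leq_size : uniq [seq T i | i <- iota 0 (size s).+1].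
  by rewrite map_inj_uniq ?iota_uniq.
by move/(_ s h); rewrite size_map size_iota ltnn.
Qed.

(* Both sides become equal after adding a point [T] in general position. *)
Lemma ec_addA (A B C : pt) : ec_add A (ec_add B C) = ec_add (ec_add A B) C.
Proof.
pose s := [seq ec_add X (ec_opp C) | X <- bad_points A B].
have [T] := exists_point (bad_points (ec_add A B) C ++ s ++ bad_points B C
                          ++ bad_points A (ec_add B C)).
rewrite 3!mem_cat 3!negb_or => /and4P[T1 T2 T3 T4].
apply: (ec_addI (P := T)); rewrite !(ec_addC T).
have CT : ec_add C T \notin bad_points A B.
  apply/negP => h; case/negP: T2; apply/mapP.
  by exists (ec_add C T) => //; rewrite (ec_addC C) ec_addK.
by rewrite (generic_assoc T4) (generic_assoc T3) (generic_assoc T1) generic_assoc.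
Qed.

End MordellGroup.

(* The proof [D0] is a parameter of the type so that the group structure, which
   needs it, can be inferred. *)
Definition mpoint (F : numClosedFieldType) (D : F) (D0 : D != 0) : Type :=
  ecpoint (mordell D).

Section MordellZmod.
Variables (F : numClosedFieldType) (D : F) (D0 : D != 0).

HB.instance Definition _ := Choice.copy (mpoint D0)
  {P : option (F * F) | on_curve (mordell D) P}.
HB.instance Definition _ := GRing.isZmodule.Build (mpoint D0)
  (ec_addA D0) (@ec_addC F D) (@ec_add0 F D) (@ec_addN F D).

End MordellZmod.

(** * Complex multiplication by Z[zeta_3] and c4 *)

Definition c4 (R : pzRingType) (W : weierstrass R) : R :=
  (wa1 W ^+ 2 + 4%:R * wa2 W) ^+ 2
  - 24%:R * (2%:R * wa4 W + wa1 W * wa3 W).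

(** A discrete Fourier transform: the three values summed with weights al^i leave only 3 d^2 c2, and
    with weights al^(2 i) only 3 d c1. *)
Lemma cubic_zero_on_rotations (F : numFieldType) (c3 c2 c1 c0 d al : F) :
  d != 0 -> al ^+ 2 + al + 1 = 0 ->
  (forall i : nat, (i < 3)%N -> let w := al ^+ i * d in
     c3 * w ^+ 3 + c2 * w ^+ 2 + c1 * w + c0 = 0) ->
  c2 = 0 /\ c1 = 0.
Proof.
move=> d0 al2 h; have al3 : al ^+ 3 = 1.
  apply/eqP; rewrite -subr_eq0; apply/eqP.
  transitivity ((al - 1) * (al ^+ 2 + al + 1)); first by ring.
  by rewrite al2 mulr0.
have := h 0%N isT; have := h 1%N isT; have := h 2 isT; cbv zeta => h2 h1 h0.
have n3 : (3%:R : F) != 0 by rewrite pnatr_eq0.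
split.
  have : 3%:R * d ^+ 2 * c2 = 0.
    transitivity ((c3 * (al ^+ 0 * d) ^+ 3 + c2 * (al ^+ 0 * d) ^+ 2 + c1 * (al ^+ 0
      * d) + c0)
      + al * (c3 * (al ^+ 1 * d) ^+ 3 + c2 * (al ^+ 1 * d) ^+ 2 + c1 * (al ^+ 1 * d)
        + c0)
      + al ^+ 2 * (c3 * (al ^+ 2 * d) ^+ 3 + c2 * (al ^+ 2 * d) ^+ 2 + c1 * (al ^+ 2
        * d) + c0)
      - (al ^+ 2 + al + 1) * (c3 * d ^+ 3 + c1 * d * (al ^+ 2 - al + 1) + c0)
      - (al ^+ 3 - 1) * (c3 * d ^+ 3 * (al + (al ^+ 3 + 1) * al ^+ 2) + c2 * d ^+ 2 *
        (1 + (al ^+ 3 + 1)))).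
      by ring.
    by rewrite h0 h1 h2 al2 al3; ring.
  by move/eqP; rewrite !mulf_eq0 (negPf n3) (negPf d0) /= => /eqP.
have : 3%:R * d * c1 = 0.
  transitivity ((c3 * (al ^+ 0 * d) ^+ 3 + c2 * (al ^+ 0 * d) ^+ 2 + c1 * (al ^+ 0 *
    d) + c0)
      + al ^+ 2 * (c3 * (al ^+ 1 * d) ^+ 3 + c2 * (al ^+ 1 * d) ^+ 2 + c1 * (al ^+ 1
        * d) + c0)
      + al ^+ 4 * (c3 * (al ^+ 2 * d) ^+ 3 + c2 * (al ^+ 2 * d) ^+ 2 + c1 * (al ^+ 2
        * d) + c0)
      - (al ^+ 2 + al + 1) * (al ^+ 2 - al + 1) * (c3 * d ^+ 3 + c0)
      - (al ^+ 2 + al + 1) * (c2 * d ^+ 2)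
      - (al ^+ 3 - 1) * (c3 * d ^+ 3 * (al ^+ 2 + (al ^+ 3 + 1) * al ^+ 4) + c1 * d *
        (1 + (al ^+ 3 + 1))
        + c2 * d ^+ 2 * (al + (al ^+ 3 + 1) * al ^+ 2))).
    by ring.
  by rewrite h0 h1 h2 al2 al3; ring.
by move/eqP; rewrite !mulf_eq0 (negPf n3) (negPf d0) /= => /eqP.
Qed.

(** * Functions on the affine curve and the abscissa of an endomorphism of order 3 *)

Section CurveFunctions.

Variables (F : numClosedFieldType) (E : weierstrass F).
Local Notation a1 := (wa1 E).
Local Notation a2 := (wa2 E).
Local Notation a3 := (wa3 E).
Local Notation a4 := (wa4 E).
Local Notation a6 := (wa6 E).
Local Notation pt := (ecpoint E).

Definition affine (x y : F) : Prop := on_curve E (Some (x, y)).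

Definition apoint x y (h : affine x y) : pt := exist (on_curve E) (Some (x, y)) h.

Lemma affineP x y : affine x y <->
  y ^+ 2 = x ^+ 3 + a2 * x ^+ 2 + a4 * x + a6 - a1 * x * y - a3 * y.
Proof.
rewrite /affine /=; split=> [/eqP e|->]; last by apply/eqP; ring.
by rewrite -e; ring.
Qed.

(** The 2-division polynomial 4 x^3 + b2 x^2 + 2 b4 x + b6. It is also the discriminant of the
    Weierstrass equation as a quadratic in y. *)
Definition two_tors : {poly F} :=
  4%:R *: 'X^3 + (a1 ^+ 2 + 4%:R * a2) *: 'X^2
  + (2%:R * (2%:R * a4 + a1 * a3)) *: 'X + (a3 ^+ 2 + 4%:R * a6)%:P.

Lemma horner_two_tors x : two_tors.[x] = 4%:R * x ^+ 3
  + (a1 ^+ 2 + 4%:R * a2) * x ^+ 2 + 2%:R * (2%:R * a4 + a1 * a3) * x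
  + (a3 ^+ 2 + 4%:R * a6).
Proof. by rewrite /two_tors !hornerE. Qed.

Lemma two_torsE x y : affine x y -> (2%:R * y + a1 * x + a3) ^+ 2 = two_tors.[x].
Proof.
move/affineP => e; rewrite horner_two_tors.
transitivity (4%:R * y ^+ 2 + (a1 * x + a3) ^+ 2 + 4%:R * y * (a1 * x + a3));
  first by ring.
by rewrite e; ring.
Qed.

Lemma affine_opp x y : affine x y -> affine x (- y - a1 * x - a3).
Proof. by move=> h; have := opp_subproof (apoint h). Qed.

Lemma affine_lift x : exists y, affine x y.
Proof.
exists ((sqrtC two_tors.[x] - a1 * x - a3) / 2%:R); apply/affineP.
set s := sqrtC _; have s2 : s ^+ 2 = two_tors.[x] by rewrite sqrtCK.
have n2 : (2%:R : F) != 0 by rewrite pnatr_eq0.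
have n4 : (4%:R : F) != 0 by rewrite pnatr_eq0.
apply: (mulfI n4); apply/eqP; rewrite -subr_eq0; apply/eqP.
transitivity (s ^+ 2 - two_tors.[x]); last by rewrite s2 subrr.
by rewrite horner_two_tors; field.
Qed.

Lemma two_tors_neq0 : two_tors != 0.
Proof.
apply/eqP => /(congr1 (fun p : {poly F} => p`_3)).
rewrite /two_tors !coefE /= => /eqP; rewrite !mulr0 mulr1 !addr0 pnatr_eq0 //.
Qed.

Definition caffine (x y : F) : 'I_3 -> F := fun i => [:: x; y; 1]`_i.

Lemma mpoly_on_curve (f : {mpoly F[3]}) : exists A B : {poly F},
  forall x y, affine x y -> f.@[caffine x y] = A.[x] + B.[x] * y.
Proof.
pose cl (f : {mpoly F[3]}) := exists A B : {poly F},
  forall x y, affine x y -> f.@[caffine x y] = A.[x] + B.[x] * y.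
have cD g h : cl g -> cl h -> cl (g + h).
  case=> [A [B e]] [A' [B' e']]; exists (A + A'), (B + B') => x y H.
  by rewrite mevalD e // e' // !hornerD; ring.
have cM g h : cl g -> cl h -> cl (g * h).
  case=> [A [B e]] [A' [B' e']].
  pose cub : {poly F} := 'X^3 + a2 *: 'X^2 + a4 *: 'X + a6%:P.
  pose lin : {poly F} := a1 *: 'X + a3%:P.
  exists (A * A' + B * B' * cub), (A * B' + A' * B - B * B' * lin) => x y H.
  rewrite mevalM e // e' // !(hornerD, hornerN, hornerM, hornerZ, hornerXn, hornerX,
    hornerC).
  transitivity (A.[x] * A'.[x] + (A.[x] * B'.[x] + A'.[x] * B.[x]) * y + B.[x] *
    B'.[x] * y ^+ 2).
    by ring.
  by rewrite ((affineP _ _).1 H); ring.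
have cC c : cl c%:MP by exists c%:P, 0 => x y _; rewrite mevalC !hornerE; ring.
have cX i : cl 'X_i.
  case: i => [[|[|[|//]]] h].
  - by exists 'X, 0 => x y _; rewrite mevalXU !hornerE /caffine /=; ring.
  - by exists 0, 1 => x y _; rewrite mevalXU !hornerE /caffine /=; ring.
  - by exists 1, 0 => x y _; rewrite mevalXU !hornerE /caffine /=; ring.
rewrite -/(cl f); elim/mpolyind: f => [|c m p _ _ IH]; first exact: (cC 0).
apply: (cD) => //; rewrite -mul_mpolyC; apply: (cM) => //.
rewrite mpolyXE_id; elim/big_rec: _ => [|i q _ Hq]; first exact: (cC 1).
by apply: (cM) => //; elim: (m i) => [|n IHn]; [exact: (cC 1) | rewrite exprS;
  apply: (cM)].
Qed.

(* Functions on the affine curve are written [A + B y]; comparing the values at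
   a point and at its opposite separates [A] from [B]. *)
Lemma curve_fun_eq0 (A B N : {poly F}) : N != 0 ->
  (forall x y, affine x y -> N.[x] != 0 -> A.[x] + B.[x] * y = 0) -> A = 0 /\ B = 0.
Proof.
move=> N0 h.
have zero p : (forall x, N.[x] != 0 -> p.[x] = 0) -> p = 0.
  move=> hp; have /eqP : N * p = 0.
    apply/eqP; apply: contraT => /closed_nonrootP[x /negP[]].
    rewrite rootE hornerM mulf_eq0; have [//|/hp ->] := eqVneq N.[x] 0.
    by rewrite eqxx orbT.
  by rewrite mulf_eq0 (negPf N0) => /eqP.
have /eqP : B * two_tors = 0.
  apply: zero => x Nx; have [y xy] := affine_lift x.
  have e := h _ _ xy Nx; have e' := h _ _ (affine_opp xy) Nx.
  have e2 : B.[x] * (2%:R * y + a1 * x + a3) = 0.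
    by rewrite -[RHS](subrr 0) -{1}e -e'; ring.
  by rewrite hornerM -(two_torsE xy) expr2 mulrA e2 mul0r.
rewrite mulf_eq0 (negPf two_tors_neq0) orbF => /eqP B0; split=> //.
apply: zero => x Nx; have [y xy] := affine_lift x.
by have := h _ _ xy Nx; rewrite B0 horner0 mul0r addr0.
Qed.

Definition cub : {poly F} := 'X^3 + a2 *: 'X^2 + a4 *: 'X + a6%:P.
Definition lin : {poly F} := a1 *: 'X + a3%:P.

Lemma horner_cub x : cub.[x] = x ^+ 3 + a2 * x ^+ 2 + a4 * x + a6.
Proof. by rewrite /cub !(hornerD, hornerZ, hornerXn, hornerX, hornerC). Qed.

Lemma horner_lin x : lin.[x] = a1 * x + a3.
Proof. by rewrite /lin !(hornerD, hornerZ, hornerX, hornerC). Qed.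

Lemma two_tors_cub : two_tors = lin ^+ 2 + 4%:R *: cub.
Proof.
apply/eqP; rewrite -subr_eq0; apply: contraT => /closed_nonrootP[x /negP[]].
rewrite rootE hornerD hornerN horner_two_tors hornerD hornerZ horner_exp.
by rewrite horner_lin horner_cub; apply/eqP; ring.
Qed.

Lemma size_two_tors : size two_tors = 4.
Proof.
have -> : two_tors = Poly [:: a3 ^+ 2 + 4%:R * a6; 2%:R * (2%:R * a4 + a1 * a3);
   a1 ^+ 2 + 4%:R * a2; 4%:R].
  apply/polyP => i; rewrite coef_Poly /two_tors !coefE.
  by case: i => [|[|[|[|i]]]] /=; rewrite ?nth_nil; ring.
by rewrite (PolyK (c := 0)) //= pnatr_eq0.
Qed.

(** The polynomial is the norm of A + B y down to F[x]. If it vanished with B nonzero, then (2 A - B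
    lin)^2 = B^2 [two_tors] would equate an even degree with an odd one. *)
Lemma curve_norm_neq0 (A B : {poly F}) : ~ (A = 0 /\ B = 0) ->
  A ^+ 2 - A * B * lin - B ^+ 2 * cub != 0.
Proof.
move=> AB0; apply/eqP => e; have [B0|B0] := eqVneq B 0.
  apply: AB0; split=> //; move/eqP: e.
  by rewrite B0 expr0n mulr0 !mul0r !subr0 expf_eq0 => /eqP.
have /(congr1 (fun p : {poly F} => odd (size p).-1)) :
    (2%:R *: A - B * lin) ^+ 2 = B ^+ 2 * two_tors.
  rewrite two_tors_cub; apply/eqP; rewrite -subr_eq0; apply/eqP.
  rewrite -[RHS](scaler0 _ 4%:R) -[in RHS]e -!mul_polyC rmorph_nat; ring.
have Bs : (0 < size (B ^+ 2))%N by rewrite size_poly_gt0 expf_neq0.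
rewrite [size (_ * two_tors)]size_mul ?expf_neq0 ?two_tors_neq0 // size_two_tors.
have -> : ((size (B ^+ 2)) + 4).-2 = ((size (B ^+ 2)).-1 + 3)%N.
  by rewrite -[in LHS](prednK Bs) !addnS.
by rewrite oddD !size_exp !oddM /= !andbF.
Qed.

Variable phi : pt -> pt.
Hypotheses (phi_mor : is_morphism phi)
  (phi_opp : forall P, phi (ec_opp P) = ec_opp (phi P))
  (phi_eq0 : forall P, phi P = ec0 E -> P = ec0 E)
  (phi3 : forall P, phi (phi (phi P)) = P)
  (phi_fix2 : forall T, ec_opp T = T -> phi T = T -> T = ec0 E).

Lemma phi_affine x y (h : affine x y) : exists x' y',
  val (phi (apoint h)) = Some (x', y').
Proof.
case e: (phi (apoint h)) => [[[x' y']|] h'] /=; first by exists x', y'.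
have p0 : phi (apoint h) = ec0 E by rewrite e; apply: val_inj.
by have /(congr1 val) := phi_eq0 p0.
Qed.

(** Two points with the same abscissa are equal or opposite, and [phi] commutes with negation. *)
Lemma phi_abscissa : exists xi : F -> F, forall x y (h : affine x y),
  exists y', val (phi (apoint h)) = Some (xi x, y').
Proof.
suff /choice[xi xiP] x : exists x', forall y (h : affine x y), exists y',
    val (phi (apoint h)) = Some (x', y').
  by exists xi.
have [y h] := affine_lift x; have [x' [y' e]] := phi_affine h.
exists x' => z k; have : (z - y) * (z + y + a1 * x + a3) = 0.
  transitivity (z ^+ 2 - y ^+ 2 + (z - y) * (a1 * x + a3)); first by ring.
  by rewrite ((affineP _ _).1 h) ((affineP _ _).1 k); ring.
move/eqP; rewrite mulf_eq0 subr_eq0 => /orP[/eqP zy|/eqP zy].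
  by exists y'; rewrite -e; congr (val (phi _)); apply: val_inj; rewrite /= zy.
exists (- y' - a1 * x' - a3).
have -> : apoint k = ec_opp (apoint h).
  apply: val_inj => /=; congr (Some (_, _)); apply/eqP; rewrite -subr_eq0.
  by apply/eqP; rewrite -[RHS]zy; ring.
by rewrite phi_opp; move: e => /= ->.
Qed.

(** The forms describing [phi] near a point give the abscissa as a quotient whose denominator is
    nonzero there. Cross-multiplied, the identity holds on the whole affine curve, since where all
    the forms vanish both sides are 0. *)
Lemma phi_local (xi : F -> F) : (forall x y (h : affine x y),
    exists y', val (phi (apoint h)) = Some (xi x, y')) ->
  forall x0 y0, affine x0 y0 -> exists A0 B0 A2 B2 : {poly F},
    A2.[x0] + B2.[x0] * y0 != 0 /\
    forall x y, affine x y -> A0.[x] + B0.[x] * y = xi x * (A2.[x] + B2.[x] * y).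
Proof.
move=> xiP x0 y0 h0; have [d [f [_ f0 fP]]] := phi_mor (apoint h0).
have [A0 [B0 e0]] := mpoly_on_curve (f (Ordinal (isT : (0 < 3)%N))).
have [A2 [B2 e2]] := mpoly_on_curve (f (Ordinal (isT : (2 < 3)%N))).
exists A0, B0, A2, B2.
have coord x y (h : affine x y) i : homogeneous_coord (phi (apoint h)) i =
   caffine (xi x) (sval (cid (xiP x y h))) i.
  by case: (cid (xiP x y h)) => y' /= e; rewrite /homogeneous_coord /= e.
split.
  rewrite -e2 //; have [c c0 /(_ (Ordinal (isT : (2 < 3)%N))) ->] := fP _ f0.
  by rewrite coord /caffine /= mulr1.
move=> x y h; rewrite -e0 // -e2 //.
have [hz|hz] := pselect (exists i, (f i).@[homogeneous_coord (apoint h)] != 0).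
  have [c c0 fc] := fP _ hz.
  by rewrite (fc (Ordinal (isT : (0 < 3)%N))) (fc (Ordinal (isT : (2 < 3)%N))) !coord
    /caffine /=; ring.
have z i : (f i).@[caffine x y] = 0.
  by apply/eqP; apply: contrapT => /negP hi; apply: hz; exists i.
by rewrite !z mulr0.
Qed.

(* The abscissa of [phi] is a reduced fraction [p / q] in [x], and [q] has no
   zero since [phi] maps affine points to affine points. *)
Lemma phi_abscissa_poly : exists r : {poly F}, forall x y (h : affine x y),
  exists y', val (phi (apoint h)) = Some (r.[x], y').
Proof.
have [xi xiP] := phi_abscissa; have loc := phi_local xiP.
suff [r rP] : exists r : {poly F}, forall x, xi x = r.[x].
  by exists r => x y h; rewrite -rP.
have [y00 h00] := affine_lift 0; have [A0 [B0 [A2 [B2 [n0 e]]]]] := loc _ _ h00.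
(* With f0 = A0 + B0 y and f2 = A2 + B2 y, the relation f0 = xi f2 is multiplied by the conjugate of
   f2 and added to its own conjugate: [N] is twice the norm of f2 and [M] the trace of f0 times the
   conjugate of f2. *)
pose N := 2%:R *: (A2 ^+ 2 - A2 * B2 * lin - B2 ^+ 2 * cub).
pose M := 2%:R *: (A0 * A2) - (A0 * B2 + A2 * B0) * lin - 2%:R *: (B0 * B2 * cub).
have N0 : N != 0.
  rewrite scaler_eq0 pnatr_eq0 /= curve_norm_neq0 // => - [A20 B20].
  by rewrite A20 B20 !horner0 mul0r addr0 eqxx in n0.
have NM x : xi x * N.[x] = M.[x].
  have [y xy] := affine_lift x.
  have e1 := e _ _ xy; have e2 := e _ _ (affine_opp xy).
  have ce : cub.[x] = y ^+ 2 + lin.[x] * y.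
    by rewrite horner_cub horner_lin ((affineP _ _).1 xy); ring.
  pose y' := - y - a1 * x - a3.
  have le : lin.[x] = - y - y' by rewrite horner_lin /y'; ring.
  rewrite /N /M; move: cub lin ce le => cu li ce le.
  rewrite !(hornerZ, hornerD, hornerN, hornerM, horner_exp) ce le.
  transitivity (2%:R * (xi x * (A2.[x] + B2.[x] * y) * (A2.[x] + B2.[x] * y')));
    first by ring.
  transitivity ((xi x * (A2.[x] + B2.[x] * y)) * (A2.[x] + B2.[x] * y')
     + (xi x * (A2.[x] + B2.[x] * y')) * (A2.[x] + B2.[x] * y)); first by ring.
  by rewrite -e1 -e2 -/y'; ring.
pose g := gcdp N M; pose q := N %/ g; pose p := M %/ g.
have g0 : g != 0 by rewrite gcdp_eq0 negb_and N0.
have Ng : N = q * g by rewrite divpK // dvdp_gcdl.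
have Mg : M = p * g by rewrite divpK // dvdp_gcdr.
have cpq : coprimep q p by rewrite coprimep_div_gcd // N0.
have xiq x : xi x * q.[x] = p.[x].
  (* At zeros of [N] the factor [g] cannot be cancelled. A quotient valid at [x] is therefore
     compared with p / q off these zeros, and [curve_fun_eq0] extends the equality to [x]. *)
  have [y xy] := affine_lift x; have [A [B [A' [B' [n' e']]]]] := loc _ _ xy.
  have [|eA eB] := @curve_fun_eq0 (A * q - p * A') (B * q - p * B') N N0.
    move=> t s ts Nt; have gt : g.[t] != 0.
      by apply: contraNneq Nt => gt; rewrite Ng hornerM gt mulr0.
    have et : xi t * q.[t] = p.[t].
      by apply: (mulIf gt); rewrite -mulrA -!hornerM -Ng -Mg NM.
    rewrite !(hornerD, hornerN, hornerM).
    transitivity ((A.[t] + B.[t] * s) * q.[t] - p.[t] * (A'.[t] + B'.[t] * s));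
      first by ring.
    by rewrite e' // -et; ring.
  apply: (mulIf n').
  transitivity ((A.[x] + B.[x] * y) * q.[x]); first by rewrite e' //; ring.
  have := congr1 (horner^~ x) eA; have := congr1 (horner^~ x) eB.
  rewrite !(hornerD, hornerN, hornerM) horner0 => /subr0_eq hB /subr0_eq hA.
  by rewrite mulrDl hA mulrAC hB; ring.
have [/closed_rootP[x /rootP qx]|] := boolP (size q != 1%N).
  have /coprimepP := cpq; have := xiq x; rewrite qx mulr0 => /esym px.
  move/(_ ('X - x%:P)); rewrite !dvdp_XsubCl !rootE qx px eqxx => /(_ isT isT).
  by rewrite -size_poly_eq1 size_XsubC.
rewrite negbK => /size_poly1P[c c0 qc]; exists (c^-1 *: p) => x.
by rewrite hornerZ -xiq qc hornerC; field.
Qed.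

Lemma phi_c4 : c4 E = 0.
Proof.
have [r rP] := phi_abscissa_poly.
have r3 x : r.[r.[r.[x]]] = x.
  have [y h] := affine_lift x; have [y1 e1] := rP _ _ h.
  have h1 : affine r.[x] y1 by have := valP (phi (apoint h)); rewrite e1.
  have p1 : phi (apoint h) = apoint h1 by exact: val_inj.
  have [y2 e2] := rP _ _ h1.
  have h2 : affine r.[r.[x]] y2 by have := valP (phi (apoint h1)); rewrite e2.
  have p2 : phi (apoint h1) = apoint h2 by exact: val_inj.
  have [y3 e3] := rP _ _ h2.
  have /(congr1 val) := phi3 (apoint h); rewrite p1 p2 e3 /=.
  by case.
have rX : r \Po (r \Po r) = 'X.
  apply/eqP; rewrite -subr_eq0; apply: contraT => /closed_nonrootP[x /negP[]].
  by rewrite rootE hornerD hornerN !horner_comp r3 hornerX subrr.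
have sr : size r = 2.
  (* Degrees multiply under composition, so the cube of the degree of [r] is 1. *)
  have := congr1 (fun p : {poly F} => (size p).-1) rX.
  rewrite !size_comp_poly size_polyX /=; by case: (size r) => [|[|[|n]]].
pose al := r`_1; pose be := r`_0.
have rE x : r.[x] = al * x + be.
  by rewrite horner_coef sr !big_ord_recl big_ord0 /= mulr1 expr1 /al /be; ring.
have [e eR] : exists e, root two_tors e.
  by apply/closed_rootP; rewrite size_two_tors.
have tors t : root two_tors t -> root two_tors r.[t] /\ r.[t] != t.
  move=> /rootP t0; have [s ts] := affine_lift t.
  have st : 2%:R * s + a1 * t + a3 = 0.
    by apply/eqP; have /eqP := two_torsE ts; rewrite t0 expf_eq0.
  have oT : ec_opp (apoint ts) = apoint ts.
    apply: val_inj => /=; congr (Some (_, _)); apply/eqP; rewrite -subr_eq0 -oppr_eq0.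
    by apply/eqP; rewrite -[RHS]st; ring.
  have [y' ey] := rP _ _ ts.
  have h' : affine r.[t] y' by have := valP (phi (apoint ts)); rewrite ey.
  have p1 : phi (apoint ts) = apoint h' by exact: val_inj.
  have oT' : ec_opp (apoint h') = apoint h' by rewrite -p1 -phi_opp oT.
  have st' : 2%:R * y' + a1 * r.[t] + a3 = 0.
    have /(congr1 val) /= [ey'] := oT'.
    transitivity (y' - (- y' - a1 * r.[t] - a3)); first by ring.
    by rewrite ey' subrr.
  split; first by rewrite rootE -(two_torsE h') st' expr0n.
  apply/eqP => rt; have /(congr1 val) // : apoint ts = ec0 E.
  apply: phi_fix2 => //; rewrite p1; apply: val_inj => /=; rewrite rt;
    congr (Some (_, _)).
  have n2 : (2%:R : F) != 0 by rewrite pnatr_eq0.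
  apply: (mulfI n2); apply: (addIr (a1 * t)); apply: (addIr a3).
  by rewrite st -{1}rt st'.
have [e1R e1n] := tors _ eR; have [e2R _] := tors _ e1R.
have al3 : al ^+ 3 = 1.
  have h1 := r3 1; have h0 := r3 0; rewrite !rE in h1 h0.
  by rewrite -[RHS]subr0 -{1}h0 -[1 in RHS]h1; ring.
have al1 : al != 1.
  apply: contraNneq e1n => al1; have h0 := r3 0; rewrite !rE al1 in h0.
  have /eqP : be *+ 3 = 0 by rewrite -h0; ring.
  by rewrite mulrn_eq0 /= rE al1 mul1r => /eqP ->; rewrite addr0.
have al2 : al ^+ 2 + al + 1 = 0.
  have : (al - 1) * (al ^+ 2 + al + 1) = 0 by transitivity (al ^+ 3 - 1);
    [ring | rewrite al3 subrr].
  by move/eqP; rewrite mulf_eq0 subr_eq0 (negPf al1) => /eqP.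
have al1' : 1 - al != 0 by rewrite subr_eq0 eq_sym.
(* [e0] is the fixed point of x -> al x + be. Around it the three 2-torsion abscissas are the
   rotations of [d]. *)
pose e0 := be / (1 - al); pose d := e - e0.
have beE : be = e0 * (1 - al) by rewrite /e0 divfK.
have d0 : d != 0.
  apply: contraNneq e1n; rewrite /d => /subr0_eq ->; rewrite rE beE; apply/eqP; ring.
have E1 : r.[e] = e0 + al * d by rewrite rE beE /d; ring.
have E2 : r.[r.[e]] = e0 + al ^+ 2 * d by rewrite E1 rE beE; ring.
have eE : e = e0 + d by rewrite /d; ring.
(* The coefficients are those of [two_tors] expanded at [e0]. The vanishing of the middle two gives
   b2 = - 12 e0 and then b2^2 = 24 b4. *)
have [] := @cubic_zero_on_rotations F 4%:R (12%:R * e0 + (a1 ^+ 2 + 4%:R * a2))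
  (12%:R * e0 ^+ 2 + 2%:R * (a1 ^+ 2 + 4%:R * a2) * e0 + 2%:R * (2%:R * a4 + a1 * a3))
  two_tors.[e0] d al d0 al2.
  move=> i i3 w; transitivity (two_tors.[e0 + w]).
    by rewrite !horner_two_tors; ring.
  apply/rootP; rewrite /w; case: i i3 {w} => [|[|[|//]]] _.
  - by rewrite mul1r -eE.
  - by rewrite expr1 -E1.
  - by rewrite -E2.
rewrite /c4; set b2 := a1 ^+ 2 + _; set b4 := _ + a1 * a3 => h2 h1.
have {}h2 : b2 = - 12%:R * e0 by rewrite -[b2](addKr (12%:R * e0)) h2; ring.
transitivity (b2 ^+ 2 - 12%:R * (12%:R * e0 ^+ 2 + 2%:R * b2 * e0 + 2%:R * b4)
  + 144%:R * e0 ^+ 2 + 24%:R * b2 * e0); first by ring.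
by rewrite h1 h2; ring.
Qed.

End CurveFunctions.

Lemma prim3_sum (R : idomainType) (z : R) : 3.-primitive_root z ->
  1 + z + z ^+ 2 = 0 /\ z ^+ 3 = 1.
Proof.
move=> zP; have z3 := prim_expr_order zP; split=> //.
have : (z - 1) * (1 + z + z ^+ 2) = 0 by transitivity (z ^+ 3 - 1);
  [ring | rewrite z3 subrr].
move/eqP; rewrite mulf_eq0 subr_eq0 => /orP[/eqP z1|/eqP //].
by have := prim_order_dvd zP 1; rewrite expr1 z1 eqxx.
Qed.

Lemma CM_c4_eq0 (F : numClosedFieldType) (E : weierstrass F) (R : idomainType) (z : R) :
  3.-primitive_root z -> has_CM_by E (Z_adjoin z) -> c4 E = 0.
Proof.
move=> /prim3_sum[zsum z3] [theta [thE _ _ th1 thDM]].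
have Z1 : Z_adjoin z 1 by exists 1; rewrite rmorph1 hornerC.
have Z0 : Z_adjoin z 0 by exists 0; rewrite rmorph0 horner0.
have ZN1 : Z_adjoin z (-1) by exists (-1); rewrite rmorphN rmorph1 hornerN hornerC.
have Zz : Z_adjoin z z by exists 'X; rewrite map_polyX hornerX.
have Z2 : Z_adjoin z (z ^+ 2) by exists 'X^2; rewrite map_polyXn hornerXn.
have Zz1 : Z_adjoin z (1 + z) by exists (1 + 'X);
  rewrite rmorphD rmorph1 /= map_polyX hornerD hornerX hornerC.
have addI (P Q : ecpoint E) : ec_add P Q = ec0 E -> P = ec_opp Q.
  case: P Q => [[[x y]|] h] [[[x' y']|] h'] /(congr1 val) //= e; last exact: val_inj.
  apply: val_inj => /=; case: andP e => // - [/eqP -> /eqP ->] _.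
  by congr (Some (_, _)); ring.
(* Associativity is established only for [mordell D], so P is cancelled by hand: if 2 P had the
   abscissa of P, the formula would make its ordinate that of -P, so P = -P and the doubling would
   give infinity. *)
have idem (P : ecpoint E) : P = ec_add P P -> P = ec0 E.
  case: P => [[[x y]|] h] /(congr1 val) //= e; last exact: val_inj.
  move: e; case: ifPn => // nopp [].
  set x3 := _ - x - x => ex; rewrite -ex subrr mulr0 add0r => ey.
  by move: nopp; rewrite eqxx /= {1}ey eqxx.
have th0 P : theta 0 P = ec0 E.
  by apply: idem; rewrite -[in LHS](addr0 0) (thDM 0 0 Z0 Z0).1.
have thN1 P : theta (-1) P = ec_opp P.
  by apply: addI; rewrite -[X in ec_add _ X]th1 -(thDM (-1) 1 ZN1 Z1).1 addNr th0.
have thz3 P : theta z (theta z (theta z P)) = P.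
  rewrite -(thDM z z Zz Zz).2 -expr2 -(thDM _ z Z2 Zz).2 -exprSr z3; exact: th1.
have [mor thz0] := thE z Zz.
apply: (@phi_c4 _ E (theta z)) => // [P|P e|T oT fT].
- rewrite -!thN1 -(thDM z (-1) Zz ZN1).2 -(thDM (-1) z ZN1 Zz).2.
  by rewrite mulrN1 mulN1r.
- by rewrite -(thz3 P) e !thz0.
(* A 2-torsion point fixed by z satisfies 0 = (1 + z + z^2) T = 3 T = T. *)
have : theta (1 + z + z ^+ 2) T = ec0 E by rewrite zsum th0.
rewrite (thDM _ _ Zz1 Z2).1 (thDM _ _ Z1 Zz).1 expr2 (thDM _ _ Zz Zz).2 !fT th1.
rewrite -{1}oT; have -> : ec_add (ec_opp T) T = ec0 E.
  by rewrite -thN1 -[X in ec_add _ X]th1 -(thDM _ _ ZN1 Z1).1 addNr th0.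
by move=> <-; apply: val_inj.
Qed.

(** * Reduction to y^2 = x^3 + D *)

(** b6 / 4 - b2^3 / 1728: the constant term left after completing the square and the cube when c4 =
    0, equal to - c6 / 864. *)
Definition mordell_coef (R : unitRingType) (W : weierstrass R) : R :=
  (wa3 W ^+ 2 + 4%:R * wa6 W) / 4%:R
  - (wa1 W ^+ 2 + 4%:R * wa2 W) ^+ 3 / 1728%:R.

Section ToMordell.

Variables (E : weierstrass algC) (u : algC).
Hypotheses (c4E : c4 E = 0) (u0 : u != 0).

Local Notation a1 := (wa1 E).
Local Notation a2 := (wa2 E).
Local Notation a3 := (wa3 E).
Local Notation a4 := (wa4 E).
Local Notation a6 := (wa6 E).

Definition mordell_map (P : option (algC * algC)) : option (algC * algC) :=
  if P is Some (x, y) then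
    Some (u ^+ 2 * (x + (a1 ^+ 2 + 4%:R * a2) / 12%:R),
          u ^+ 3 * (y + (a1 * x + a3) / 2%:R))
  else None.

Local Notation D := (u ^+ 6 * mordell_coef E).

Lemma c4_a4 : a4 = (a1 ^+ 2 + 4%:R * a2) ^+ 2 / 48%:R - a1 * a3 / 2%:R.
Proof.
have n2 : (2%:R : algC) != 0 by rewrite pnatr_eq0.
have n48 : (48%:R : algC) != 0 by rewrite pnatr_eq0.
transitivity (a4 + c4 E / 48%:R); first by rewrite c4E mul0r addr0.
by rewrite /c4; field.
Qed.

Lemma mordell_map_on P : on_curve (mordell D) (mordell_map P) = on_curve E P.
Proof.
case: P => [[x y]|] //; rewrite /mordell_map on_mordellE /=.
rewrite -subr_eq0 -[RHS]subr_eq0 c4_a4.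
set W := (X in _ = (X == 0)).
have -> : (u ^+ 3 * (y + (a1 * x + a3) / 2%:R)) ^+ 2 -
  ((u ^+ 2 * (x + (a1 ^+ 2 + 4%:R * a2) / 12%:R)) ^+ 3 + D) = u ^+ 6 * W.
  by rewrite /W /mordell_coef; field.
by rewrite mulf_eq0 expf_eq0 /= (negPf u0).
Qed.

Lemma mordell_map_inj : injective mordell_map.
Proof.
case=> [[x y]|] [[x' y']|] //= [].
move=> /(mulfI (expf_neq0 2 u0)) /addIr -> /(mulfI (expf_neq0 3 u0)) /addIr -> //.
Qed.

Lemma mordell_map_add P Q : on_curve E P -> on_curve E Q ->
  mordell_map (add_raw E P Q) = add_raw (mordell D) (mordell_map P) (mordell_map Q).
Proof.
case: P Q => [[x y]|] [[x' y']|] // h h'.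
have H := h; have H' := h'; rewrite -mordell_map_on on_mordellE in H.
rewrite -mordell_map_on on_mordellE in H'.
move/eqP: H => H; move/eqP: H' => H'.
rewrite [mordell_map (Some (x, y))]/= [mordell_map (Some (x', y'))]/=.
have n2 : (2%:R : algC) != 0 by rewrite pnatr_eq0.
rewrite [add_raw E _ _]/=; case: ifPn => [/andP[/eqP <- /eqP ->]|nopp].
  by rewrite /= eqxx /= (_ : _ == _) //; apply/eqP; field.
set l := slope E x y x' y'.
pose d := 2%:R * y + a1 * x + a3.
have same : x = x' -> y = y' /\ d != 0.
  move=> ex; rewrite -ex eqxx /= in nopp.
  have : (y' - y) * (y' + y + a1 * x + a3) = 0.
    move: h h' => /= /eqP h /eqP h'; rewrite -ex in h'.
    transitivity ((y' ^+ 2 + a1 * x * y' + a3 * y') - (y ^+ 2 + a1 * x * y + a3 *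
      y)); first by ring.
    by rewrite h h' subrr.
  move/eqP; rewrite mulf_eq0 => /orP[]; last first.
    move=> /eqP e; case/eqP: nopp; rewrite -[LHS]subr0 -e; ring.
  rewrite subr_eq0 => /eqP ey; split=> //; apply: contraNneq nopp => d0.
  by rewrite ey -subr_eq0 -d0; apply/eqP; rewrite /d; ring.
(* Completing the square adds a1 / 2 to every slope, and the scaling multiplies slopes by u^3 /
   u^2. *)
rewrite (add_lineE H H' (l := u * (l + a1 / 2%:R))) /third.
- by rewrite /=; congr (Some (_, _)); field.
- move/(mulfI (expf_neq0 2 u0))/addIr => ex; have [ey d0] := same ex.
  rewrite -ex -ey -addr_eq0.
  have -> : u ^+ 3 * (y + (a1 * x + a3) / 2%:R) + u ^+ 3 * (y + (a1 * x + a3) /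
    2%:R) = u ^+ 3 * d.
    by rewrite /d; field.
  by rewrite mulf_neq0 ?expf_neq0.
- have [ex|nex] := eqVneq x x'.
    by have [ey _] := same ex; rewrite -ex -ey; ring.
  have nx : x' - x != 0 by rewrite subr_eq0 eq_sym.
  by rewrite /l /slope (negPf nex); field.
apply: (on_lineP H H').
  have [ex|nex] := eqVneq x x'.
    by have [ey _] := same ex; rewrite -ex -ey; ring.
  have nx : x' - x != 0 by rewrite subr_eq0 eq_sym.
  by rewrite /l /slope (negPf nex); field.
move/(mulfI (expf_neq0 2 u0))/addIr => ex; have [ey d0] := same ex.
rewrite /l /slope ex eqxx -ex; rewrite /d in d0; rewrite c4_a4; field.
by rewrite d0.
Qed.

End ToMordell.

(** * Transport of the points over a subfield into one group *)

Section PointMap.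

Variables (F : fieldType) (f : {rmorphism F -> algC}) (W : weierstrass F).
Variables (E : weierstrass algC) (u D : algC) (D0 : D != 0).
Hypotheses (WE : base_change f W = E) (c4E : c4 E = 0) (u0 : u != 0).
Hypothesis DE : D = u ^+ 6 * mordell_coef E.

Definition fpair (P : option (F * F)) : option (algC * algC) :=
  if P is Some (x, y) then Some (f x, f y) else None.

Lemma fpair_on P : on_curve E (fpair P) = on_curve W P.
Proof.
case: P => [[x y]|] //=; rewrite -WE /= -!rmorphXn -!rmorphM -!rmorphD.
by rewrite fmorph_eq.
Qed.

Lemma fpair_add P Q : fpair (add_raw W P Q) = add_raw E (fpair P) (fpair Q).
Proof.
case: P Q => [[x y]|] [[x' y']|] //=; rewrite -WE /=.
rewrite fmorph_eq -(rmorphM f (wa1 W) x) -!rmorphN -!rmorphD fmorph_eq.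
case: ifP => // _ /=.
have -> : slope (base_change f W) (f x) (f y) (f x') (f y') = f (slope W x y x' y').
  rewrite /slope fmorph_eq; case: ifP => _ /=;
  by rewrite fmorph_div ?(rmorphD, rmorphB, rmorphM, rmorphXn, rmorph_nat, rmorphN).
by rewrite ?(rmorphD, rmorphB, rmorphM, rmorphXn, rmorph_nat, rmorphN).
Qed.

Lemma point_map_on (P : ecpoint W) : on_curve (mordell D) (mordell_map E u (fpair
  (val P))).
Proof. by rewrite DE mordell_map_on // fpair_on; apply: valP. Qed.

Definition point_map (P : ecpoint W) : mpoint D0 :=
  exist (on_curve (mordell D)) _ (point_map_on P).

Lemma val_point_map P : val (point_map P) = mordell_map E u (fpair (val P)).
Proof. by []. Qed.

Lemma point_map0 : point_map (ec0 W) = 0.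
Proof. exact: val_inj. Qed.

Lemma point_map_add P Q : point_map (ec_add P Q) = point_map P + point_map Q.
Proof.
apply: val_inj; rewrite [RHS](val_ec_add (point_map P) (point_map Q)) !val_point_map.
rewrite -[val (ec_add P Q)]/(add_raw W (val P) (val Q)) fpair_add DE.
by apply: mordell_map_add => //; rewrite fpair_on; apply: valP.
Qed.

Lemma point_map_inj : injective point_map.
Proof.
move=> P Q /(congr1 val); rewrite !val_point_map => /(mordell_map_inj u0) e.
apply: val_inj; move: e; case: (val P) (val Q) => [[x y]|] [[x' y']|] //= [].
by move=> /fmorph_inj -> /fmorph_inj ->.
Qed.

Lemma point_map_opp P : point_map (ec_opp P) = - point_map P.
Proof.
apply: (addrI (point_map P)); rewrite subrr -point_map_add -point_map0; congr point_map.
apply: val_inj; case: P => [[[x y]|] h] //=; rewrite eqxx /=.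
by rewrite (_ : _ == _) //; apply/eqP.
Qed.

Lemma point_map_mulz P m : point_map (ec_mulz P m) = point_map P *~ m.
Proof.
have it Q n : point_map (iter n (ec_add Q) (ec0 W)) = point_map Q *+ n.
  by elim: n => [|n IH]; rewrite ?point_map0 //= point_map_add IH mulrS.
by case: m => n; rewrite /ec_mulz it ?point_map_opp // NegzE mulrNz -pmulrn mulNrn.
Qed.

Lemma z_independent_point_map n (P : 'I_n -> ecpoint W) :
  z_independent P <-> (forall c : 'I_n -> int, \sum_i point_map (P i) *~ c i = 0 ->
                       forall i, c i = 0).
Proof.
have e c : point_map (\big[@ec_add F W/ec0 W]_i ec_mulz (P i) (c i)) =
    \sum_i point_map (P i) *~ c i.
  rewrite (big_morph point_map point_map_add point_map0).
  by apply: eq_bigr => i _; rewrite point_map_mulz.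
split=> [ind c c0|ind c c0]; apply: ind.
  by apply: point_map_inj; rewrite e c0 point_map0.
by rewrite -e c0 point_map0.
Qed.

Lemma point_map_surj (Q : mpoint D0) x y :
  val Q = mordell_map E u (Some (f x, f y)) -> exists P : ecpoint W, point_map P = Q.
Proof.
move=> eQ; have h : on_curve W (Some (x, y)).
  by rewrite -fpair_on -(mordell_map_on c4E u0) -DE [fpair _]/= -eQ; apply: valP.
by exists (exist (on_curve W) _ h); apply: val_inj; rewrite val_point_map eQ.
Qed.

End PointMap.

(** * Torsion and twisted points *)

Section TwoAdic.

(* The localization of the algebraic integers at [1 + 2 Aint]: there [2] is not
   invertible, but every element of [1 + 2 Aint2] is. *)
Definition Aint2 : {pred algC} := fun z =>
  `[< exists uv : algC * algC, [/\ uv.1 \in Aint,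
    uv.2 \in Aint & z * (1 + 2%:R * uv.1) = uv.2] >].

Lemma Aint2P z : reflect (exists uv : algC * algC,
  [/\ uv.1 \in Aint, uv.2 \in Aint & z * (1 + 2%:R * uv.1) = uv.2]) (z \in Aint2).
Proof. exact: asboolP. Qed.

Lemma half_notin_Aint : (2%:R^-1 : algC) \notin Aint.
Proof.
apply/negP => /(Cint_rat_Aint _) h.
have /h /intrP[m e] : (2%:R^-1 : algC) \in Crat by rewrite rpredV rpred_nat.
have : (m%:~R * 2%:R : algC) == 1 by rewrite -e mulVf ?pnatr_eq0.
rewrite -[2%:R]/((2 : int)%:~R) -intrM -[1]/(1%:~R) eqr_int => /eqP e2.
have : (2 %| m * 2)%Z by rewrite dvdz_mull.
by rewrite e2.
Qed.

Lemma odd_Aint_neq0 u : u \in Aint -> 1 + 2%:R * u != 0 :> algC.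
Proof.
move=> uA; apply: contraNneq half_notin_Aint => e.
suff -> : (2%:R^-1 : algC) = - u by rewrite rpredN.
have n2 : (2%:R : algC) != 0 by rewrite pnatr_eq0.
apply: (mulfI n2); rewrite mulfV // mulrN -[RHS]add0r -e; ring.
Qed.

Lemma Aint_Aint2 : {subset Aint <= Aint2}.
Proof.
by move=> v vA; apply/Aint2P; exists (0, v); rewrite /= rpred0; split=> //; ring.
Qed.

Fact Aint2_subring : subring_closed Aint2.
Proof.
split; first by rewrite Aint_Aint2 ?rpred1.
  move=> x y /Aint2P[[u v] /= [uA vA e]] /Aint2P[[u' v'] /= [uA' vA' e']].
  apply/Aint2P; exists (u + u' + 2%:R * u * u',
    v * (1 + 2%:R * u') - v' * (1 + 2%:R * u)) => /=.
  split; first by rewrite ?(rpredD, rpredM, rpred_nat).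
    by rewrite rpredB // rpredM // rpredD ?rpred1 // rpredM ?rpred_nat.
  by rewrite -e -e'; ring.
move=> x y /Aint2P[[u v] /= [uA vA e]] /Aint2P[[u' v'] /= [uA' vA' e']].
apply/Aint2P; exists (u + u' + 2%:R * u * u', v * v') => /=.
split; [by rewrite ?(rpredD, rpredM, rpred_nat) | by rewrite rpredM | by rewrite -e
  -e'; ring].
Qed.

HB.instance Definition _ := GRing.isSubringClosed.Build algC Aint2 Aint2_subring.

Lemma odd_Aint2_inv x : x \in Aint2 -> 1 + 2%:R * x != 0 /\ (1 + 2%:R * x)^-1 \in Aint2.
Proof.
case/Aint2P => [[u v] /= [uA vA e]]; have u0 := odd_Aint_neq0 uA.
have uvA : u + v \in Aint by rewrite rpredD.
have uv0 := odd_Aint_neq0 uvA.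
have xE : 1 + 2%:R * x = (1 + 2%:R * (u + v)) / (1 + 2%:R * u).
  by apply: (mulIf u0); rewrite divfK // mulrDr -e; ring.
rewrite xE; split; first by rewrite mulf_neq0 ?invr_eq0.
apply/Aint2P; exists (u + v, 1 + 2%:R * u) => /=; split=> //.
  by rewrite rpredD ?rpred1 // rpredM ?rpred_nat.
by rewrite invf_div divfK.
Qed.

Lemma half_notin_Aint2 : 2%:R^-1 \notin Aint2.
Proof.
apply/Aint2P => - [[u v] /= [uA vA e]]; case/negP: half_notin_Aint.
have -> : (2%:R^-1 : algC) = v - u by rewrite -e; field; rewrite ?pnatr_eq0.
by rewrite rpredB.
Qed.

End TwoAdic.

Lemma zmod_closed_sum (V : zmodType) (S : {pred V}) : zmod_closed S ->
  forall n (v : 'I_n -> V) (c : 'I_n -> int), (forall i, v i \in S) ->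
  \sum_i v i *~ c i \in S.
Proof.
move=> cl n v c vS.
pose S' : zmodClosed V := HB.pack (S : V -> bool) (GRing.isZmodClosed.Build V S cl).
by apply: (rpred_sum (S := S')) => i _; apply: (@rpredMz _ S'); apply: vS.
Qed.

Section MordellArithmetic.

Variables (D : algC) (D0 : D != 0).
Local Notation G := (mpoint D0).

(** The ordinate of 2 P involves [x] only through x^3 = y^2 - D, so iterated doubling is a recursion
    on ordinates alone. *)
Lemma mordell_double (P : G) x y : val P = Some (x, y) -> y != 0 ->
  exists x', val (P + P) = Some (x', (y ^+ 4 + 18%:R * D * y ^+ 2 - 27%:R * D ^+ 2) /
    (8%:R * y ^+ 3)).
Proof.
move=> eP y0; rewrite [val _](val_ec_add P P) eP.
have h : y ^+ 2 = x ^+ 3 + D by apply/eqP; rewrite -on_mordellE -eP; apply: valP.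
case: (addP h h) => [_ ey|l _ _ ol].
  by move/eqP: ey; rewrite -addr_eq0 -mulr2n mulrn_eq0 /= (negPf y0).
exists (l ^+ 2 - x - x); rewrite /third; congr (Some (_, _)).
have := on_line_tangent h ol; rewrite subrr mul0r => /subr0_eq tl.
have n2 : (2%:R : algC) != 0 by rewrite pnatr_eq0.
have lE : l = 3%:R * x ^+ 2 / (2%:R * y).
  by rewrite tl mulrC mulKf // mulf_neq0.
have DE : D = y ^+ 2 - x ^+ 3 by rewrite h; ring.
rewrite lE DE; field.
by rewrite y0.
Qed.

(* Up to a 2-adic unit, doubling [P] divides its ordinate by [8]. *)
Lemma mordell_nontorsion (P : G) x y : val P = Some (x, y) -> y != 0 ->
  (exists2 rho, rho \in Aint2 & D / y ^+ 2 = 2%:R * rho) ->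
  forall n, P *+ n = 0 -> n = 0%N.
Proof.
move=> eP y0 [rho rhoA rhoE].
have n8 : (8%:R : algC) != 0 by rewrite pnatr_eq0.
have orbit i : exists x' e, [/\ e != 0, e \in Aint2, e^-1 \in Aint2 &
    val (P *+ 2 ^ i) = Some (x', y * e / 8%:R ^+ i)].
  elim: i => [|i [x' [e [e0 eA eVA ei]]]].
    by exists x, 1; rewrite oner_eq0 expr0 !invr1 rpred1 !mulr1 expn0 mulr1n eP.
  have yi0 : y * e / 8%:R ^+ i != 0 by rewrite !mulf_neq0 ?invr_eq0 ?expf_neq0.
  have [x'' e''] := mordell_double ei yi0.
  (* 2 [sg] is D over the square of the current ordinate, so doubling multiplies the ordinate by (1
     + 36 sg - 108 sg^2) / 8. *)
  pose sg := 8%:R ^+ i ^+ 2 * rho * e^-1 ^+ 2.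
  have sgA : sg \in Aint2 by rewrite !rpredM ?rpredX ?rpred_nat.
  have tA : 18%:R * sg - 54%:R * sg ^+ 2 \in Aint2.
    by rewrite rpredB ?rpredM ?rpredX ?rpred_nat.
  have [t0 tVA] := odd_Aint2_inv tA.
  exists x'', (e * (1 + 2%:R * (18%:R * sg - 54%:R * sg ^+ 2))); split.
  - by rewrite mulf_neq0.
  - by rewrite rpredM // rpredD ?rpred1 // rpredM ?rpred_nat.
  - by rewrite invfM rpredM.
  rewrite expnS mulnC mulrnA mulr2n e''; congr (Some (_, _)).
  have DE : D = 2%:R * rho * y ^+ 2 by rewrite -rhoE divfK // expf_neq0.
  rewrite DE /sg (exprS 8%:R i); move: (8%:R ^+ i) (expf_neq0 i n8) => q q0.
  by field; rewrite y0 e0 q0.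
move=> n nP; apply/eqP; apply: contraT; rewrite -lt0n => n0.
(* If n = 2^s m with m odd and n P = 0, Euler's theorem with t = [totient m] gives 2^(s+t) P = 2^s
   P. Comparing ordinates, 8^t is a unit of [Aint2], and so 1/2 lies in it. *)
have [m m2 nE] := pfactor_coprime (isT : prime 2) n0; set s := logn 2 n in nE.
have m0 : (0 < m)%N by case: m m2 nE => // _; rewrite mul0n => e; rewrite e in n0.
pose t := totient m; have t0 : (0 < t)%N by rewrite totient_gt0.
have dv : (m %| 2 ^ t - 1)%N.
  by have := Euler_exp_totient m2; move/eqP; rewrite eqn_mod_dvd // expn_gt0.
have PP : P *+ 2 ^ (s + t) = P *+ 2 ^ s.
  have -> : (2 ^ (s + t) = 2 ^ s * (2 ^ t - 1) + 2 ^ s)%N.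
    by rewrite expnD mulnBr muln1 subnK // leq_pmulr // expn_gt0.
  case/dvdnP: dv => d ->; rewrite mulrnDr (_ : 2 ^ s * (d * m) = n * d)%N; last first.
    by rewrite nE mulnC -mulnA mulnC.
  by rewrite mulrnA nP mul0rn add0r.
have [x1 [e1 [e10 e1A e1VA E1]]] := orbit s;
  have [x2 [e2 [e20 e2A e2VA E2]]] := orbit (s + t)%N.
move: E2; rewrite PP E1 => - [_ ye].
have e8 : (8%:R^-1 : algC) ^+ t = e1 * e2^-1.
  rewrite exprVn; have q0 := expf_neq0 s n8; have r0 := expf_neq0 t n8.
  rewrite exprD in ye; move: ye; move: (8%:R ^+ s) (8%:R ^+ t) q0 r0 => q r q0 r0 ye.
  have : y * e1 / q * (q * r / (y * e2)) = y * e2 / (q * r) * (q * r /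
    (y * e2)) by rewrite ye.
  have -> : y * e1 / q * (q * r / (y * e2)) = r * (e1 / e2) by field; rewrite y0 e20 q0.
  have -> : y * e2 / (q * r) * (q * r / (y * e2)) = 1 by field; rewrite y0 e20 q0 r0.
  by move=> re; apply: (mulfI r0); rewrite re mulfV.
case/negP: half_notin_Aint2.
have -> : (2%:R^-1 : algC) = 4%:R * 8%:R ^+ t.-1 * (8%:R^-1) ^+ t.
  rewrite -{2}(prednK t0) exprS exprVn; have := expf_neq0 t.-1 n8.
  by move: (8%:R ^+ t.-1) => q q0; field; rewrite q0 ?pnatr_eq0.
by rewrite e8 !rpredM ?rpredX ?rpred_nat.
Qed.

(** * Points of a cubic twist *)

Section TwistedPoints.

Variables (k : divringClosed algC) (a al : algC).
Hypotheses (alE : al ^+ 3 = a) (ak : a \in k) (al0 : al != 0).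

(* These are the rational points of the cubic twist [y^2 = a x^3 + D]. *)
Definition twisted : {pred G} := fun P : G =>
  if val P is Some (x, y) then (x / al \in k) && (y \in k) else true.

Lemma twistedP (P : G) x y : val P = Some (x, y) ->
  (P \in twisted) = (x / al \in k) && (y \in k).
Proof. by rewrite /twisted unfold_in => ->. Qed.

(** For a chord or a tangent [l * al] lies in [k], and the addition formulas can be rewritten in
    terms of [l * al], [x / al] and a. Taking a = al = 1 gives the group of [k]-rational points. *)
Fact twisted_zmod_closed : zmod_closed twisted.
Proof.
have add P Q : P \in twisted -> Q \in twisted -> P + Q \in twisted.
  case: (ptP P) => [->|[x [y [h eP]]]]; first by rewrite [_ + _](ec_add0 Q).
  case: (ptP Q) => [->|[x' [y' [h' eQ]]]].
    by rewrite [_ + _](ec_addC P) [ec_add _ _](ec_add0 P).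
  rewrite (twistedP eP) (twistedP eQ) => /andP[xk yk] /andP[xk' yk'].
  rewrite /twisted unfold_in [val _](val_ec_add P Q) eP eQ.
  case: (addP h h') => [//|l tl yl ol]; rewrite /third.
  have lk : l * al \in k.
    have [ex|nex] := eqVneq x x'.
      have [ey y0] := tl ex; have := on_line_tangent h ol; rewrite -ex subrr mul0r.
      move=> /subr0_eq tg.
      have n2 : (2%:R : algC) != 0 by rewrite pnatr_eq0.
      have -> : l * al = 3%:R * (x / al) ^+ 2 * a / (2%:R * y).
        have -> : l = 3%:R * x ^+ 2 / (2%:R * y) by rewrite tg mulrC mulKf // mulf_neq0.
        by rewrite -alE; field; rewrite al0 y0.
      move: (x / al) xk => X Xk.
      by rewrite rpred_div ?(rpred_nat, rpredX, rpredM).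
    have nx : x' - x != 0 by rewrite subr_eq0 eq_sym.
    have -> : l * al = (y' - y) / (x' / al - x / al).
      by rewrite yl -mulrBl; field; rewrite al0 nx.
    by rewrite rpred_div // rpredB.
  have x3k : (l ^+ 2 - x - x') / al \in k.
    have -> : (l ^+ 2 - x - x') / al = (l * al) ^+ 2 / a - x / al - x' / al.
      by rewrite -alE; field.
    by rewrite !rpredB // rpred_div ?rpredX.
  rewrite x3k /= rpredN rpredD //.
  have -> : l * (l ^+ 2 - x - x' - x) = (l * al) * ((l ^+ 2 - x - x') / al - x / al).
    by field.
  by rewrite rpredM // rpredB.
have opp P : P \in twisted -> - P \in twisted.
  case: (ptP P) => [->|[x [y [h eP]]]]; first by rewrite oppr0.
  rewrite (twistedP eP) => /andP[xk yk].
  by rewrite /twisted unfold_in [val _](val_ec_opp P) eP opp_rawE xk rpredN.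
by split=> [//|P Q Pt Qt]; apply: add => //; apply: opp.
Qed.

End TwistedPoints.

(** Such a point is a flex: its tangent is horizontal and meets the curve three times at abscissa
    0. *)
Lemma zero_abscissa_3torsion (Q : G) y : val Q = Some (0, y) -> Q *+ 3 = 0.
Proof.
move=> eQ; suff e : Q + Q = - Q by rewrite mulrS mulr2n e subrr.
have h : y ^+ 2 = 0 ^+ 3 + D by apply/eqP; rewrite -on_mordellE -eQ; apply: valP.
have y0 : y != 0 by apply: contraNneq D0 => y0; move: h;
  rewrite y0 !expr0n /= add0r => <-.
apply: val_inj; rewrite [LHS](val_ec_add Q Q) [RHS](val_ec_opp Q) eQ opp_rawE.
rewrite (@add_lineE _ D 0 y 0 y 0) //.
- by rewrite /third; congr (Some (_, _)); ring.
- by rewrite -addr_eq0 -mulr2n mulrn_eq0.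
- by ring.
- by apply: (on_lineP (y2 := y)) => //; [ring | move=> _; ring].
Qed.

(** * The automorphism given by a cube root of unity *)

Section Rotation.

Variables (w : algC).
Hypothesis w3 : w ^+ 3 = 1.

Lemma rotate_on (P : G) : on_curve (mordell D)
  (if val P is Some (x, y) then Some (w * x, y) else None).
Proof.
by case: (ptP P) => [->//|[x [y [h ->]]]]; rewrite on_mordellE exprMn w3 mul1r h.
Qed.

Definition rotate (P : G) : G := exist (on_curve (mordell D)) _ (rotate_on P).

Lemma val_rotate P : val (rotate P) = if val P is Some (x, y) then Some (w * x,
  y) else None.
Proof. by []. Qed.

Lemma rotateD : {morph rotate : P Q / P + Q}.
Proof.
move=> P Q; apply: val_inj; rewrite val_rotate.
rewrite [val (P + Q)](val_ec_add P Q) [RHS](val_ec_add (rotate P) (rotate Q))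
  !val_rotate.
case: (ptP P) => [->|[x [y [h ->]]]]; first by case: (val Q) => [[]|].
case: (ptP Q) => [->//|[x' [y' [h' ->]]]].
have w0 : w != 0 by apply: contra_eq_neq w3 => ->; rewrite expr0n eq_sym oner_eq0.
have hw t s : s ^+ 2 = t ^+ 3 + D -> s ^+ 2 = (w * t) ^+ 3 + D by rewrite exprMn w3
  mul1r.
case: (addP h h') => [ex ey|l tl yl ol].
  by rewrite /= ex ey eqxx /= mul0r !subr0 eqxx.
(* Abscissas are multiplied by [w], so slopes are divided by [w], that is, multiplied by w^2. *)
rewrite (add_lineE (hw _ _ h) (hw _ _ h') (l := l * w ^+ 2)) /third.
- have e : (l * w ^+ 2) ^+ 2 - w * x - w * x' = w * (l ^+ 2 - x - x').
    by transitivity (l ^+ 2 * w ^+ 3 * w - w * x - w * x'); [ring | rewrite w3; ring].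
  rewrite e; congr (Some (_, - _)).
  by transitivity (y + l * w ^+ 3 * (l ^+ 2 - x - x' - x)); [rewrite w3 mulr1 | ring].
- move/(mulfI w0) => ex; have [<- y0] := tl ex.
  by rewrite -addr_eq0 -mulr2n mulrn_eq0.
- transitivity (y + l * w ^+ 3 * (x' - x)); [by rewrite w3 mulr1 | ring].
- move=> t; have := ol (t * w ^+ 2).
  rewrite exprMn -exprM mulnC exprM w3 expr1n mulr1 => e.
  transitivity (t ^+ 3 + D - (y + l * (t * w ^+ 2 - x)) ^+ 2).
    congr (_ - (y + _) ^+ 2).
    by transitivity (l * (t * w ^+ 2) - l * w ^+ 3 * x); [ring | rewrite w3; ring].
  rewrite e.
  transitivity ((t * w ^+ 2 - x * w ^+ 3) * (t * w ^+ 2 - x' * w ^+ 3)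
     * (t * w ^+ 2 - (l ^+ 2 - x - x') * w ^+ 3)).
    by rewrite w3; ring.
  transitivity ((w ^+ 3) ^+ 2 * (t - w * x) * (t - w * x') * (t - (l ^+ 2 * w - w * x
    - w * x'))).
    by ring.
  rewrite w3; transitivity ((t - w * x) * (t - w * x') * (t - (l ^+ 2 * w * w ^+ 3 -
    w * x - w * x'))).
    by rewrite w3; ring.
  by ring.
Qed.

Lemma rotateMz P m : rotate (P *~ m) = rotate P *~ m.
Proof.
have r0 : rotate 0 = 0 by apply: (addrI (rotate 0)); rewrite -rotateD !addr0.
have rn (Q : G) n : rotate (Q *+ n) = rotate Q *+ n.
  by elim: n => [|n IH]; rewrite ?mulr0n // !mulrS rotateD IH.
case: m => m; rewrite ?NegzE ?mulrNz -?pmulrn ?rn //.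
by apply: (addrI (rotate (P *+ m.+1))); rewrite -rotateD !subrr r0 rn subrr.
Qed.

Hypothesis w_sum : 1 + w + w ^+ 2 = 0.

(** The three points are the intersection of the curve with a horizontal line. *)
Lemma rotate_sum (P : G) x y : val P = Some (x, y) -> x != 0 ->
  P + rotate P + rotate (rotate P) = 0.
Proof.
move=> eP x0; have h : y ^+ 2 = x ^+ 3 + D by apply/eqP; rewrite -on_mordellE -eP;
  apply: valP.
have hw : y ^+ 2 = (w * x) ^+ 3 + D by rewrite exprMn w3 mul1r.
have w1 : w != 1.
  apply: contra_eq_neq w_sum => ->; rewrite expr1n (_ : 1 + 1 + 1 = 3%:R) ?pnatr_eq0
    //; ring.
have nx : x != w * x.
  by rewrite -{1}[x]mul1r (inj_eq (mulIf x0)) eq_sym.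
suff -> : P + rotate P = - rotate (rotate P) by rewrite addNr.
apply: val_inj; rewrite [LHS](val_ec_add P (rotate P)) [RHS](val_ec_opp (rotate
  (rotate P))).
rewrite !val_rotate eP opp_rawE (add_lineE h hw (l := 0)) /third.
- congr (Some (_, _)); last by ring.
  transitivity (w * (w * x) - (1 + w + w ^+ 2) * x); first by ring.
  by rewrite w_sum; ring.
- by move=> ex; rewrite -ex eqxx in nx.
- by ring.
- by apply: (on_lineP (y2 := y)) => //; [ring | move=> ex; rewrite -ex eqxx in nx].
Qed.

(** If m + n w kills P, so does its norm m^2 - m n + n^2. As P is not torsion, this positive
    definite form vanishes at (m, n). *)
Lemma rotate_independent (P : G) x y (m n : int) : val P = Some (x, y) -> x != 0 ->
  (forall i : nat, P *+ i = 0 -> i = 0%N) ->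
  P *~ m + rotate P *~ n = 0 -> m = 0 /\ n = 0.
Proof.
move=> eP x0 free e.
have e1 : rotate P *~ n = - (P *~ m) by apply/eqP; rewrite -addr_eq0 addrC e.
have e2 : rotate (rotate P) = - P - rotate P.
  by apply: (addrI (P + rotate P)); rewrite (rotate_sum eP x0) addrACA !subrr addr0.
have e3 : rotate P *~ m = P *~ n + rotate P *~ n.
  have : rotate (P *~ m + rotate P *~ n) = 0.
    by rewrite e -(mulr0z 0) rotateMz mulr0z.
  rewrite rotateD !rotateMz e2 mulrzBl mulNrz => /eqP.
  by rewrite -opprD addr_eq0 opprK => /eqP.
have : P *~ (m ^+ 2 - m * n + n ^+ 2) = 0.
  transitivity ((P *~ n - P *~ m) *~ n + (P *~ m) *~ m).
    by rewrite mulrzBl -!mulrzA -mulrzBr -mulrzDr; congr (P *~ _); ring.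
  have -> : P *~ n - P *~ m = rotate P *~ m by rewrite e3 e1.
  rewrite -[P *~ m]opprK -e1 mulNrz -!mulrzA [n * m]mulrC; exact: subrr.
set N := _ + _ => PN; have N0 : N = 0.
  case: (N) PN => i; first by rewrite -pmulrn => /free ->.
  by rewrite NegzE mulrNz -pmulrn => /eqP; rewrite oppr_eq0 => /eqP /free.
have : (2%:R * m - n) ^+ 2 + 3%:R * n ^+ 2 = 4%:R * N by rewrite /N; ring.
have p1 : 0 <= (2%:R * m - n) ^+ 2 by rewrite sqr_ge0.
have p2 : 0 <= 3%:R * n ^+ 2 by rewrite mulr_ge0 // sqr_ge0.
rewrite N0 mulr0 => /eqP; rewrite (paddr_eq0 p1 p2) => /andP[h1].
rewrite mulf_eq0 expf_eq0 /= => /eqP n0; split=> //.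
by move: h1; rewrite n0 subr0 expf_eq0 /= mulf_eq0 /= => /eqP.
Qed.

End Rotation.

(* A point that is both [k]-rational and twisted has abscissa [0] because
   [al] is not in [k], hence is killed by [3]. *)
Lemma twisted_independent (k : divringClosed algC) (a al y w : algC) (P : G) (n : nat)
    (Q : 'I_n -> G) (w3 : w ^+ 3 = 1) :
  1 + w + w ^+ 2 = 0 -> w \in k ->
  al ^+ 3 = a -> a \in k -> al \notin k -> y \in k -> val P = Some (al, y) ->
  (forall i, P *+ i = 0 -> i = 0%N) ->
  (forall i, Q i \in twisted k 1) ->
  (forall c : 'I_n -> int, \sum_i Q i *~ c i = 0 -> forall i, c i = 0) ->
  forall (c : 'I_n -> int) (p q : int),
    \sum_i Q i *~ c i + (P *~ p + rotate w3 P *~ q) = 0 ->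
    [/\ forall i, c i = 0, p = 0 & q = 0].
Proof.
move=> ws wk alE ak alk yk eP free Qk Qind c p q e.
have al0 : al != 0 by apply: contraNneq alk => ->; rewrite rpred0.
pose R := \sum_i Q i *~ c i.
have Rk : R \in twisted k 1.
  by apply: zmod_closed_sum => //; apply: (@twisted_zmod_closed k 1);
    rewrite ?expr1n ?rpred1 ?oner_neq0.
have Pal : P \in twisted k al by rewrite (twistedP _ _ eP) divff // rpred1.
have P'al : rotate w3 P \in twisted k al.
  have eP' : val (rotate w3 P) = Some (w * al, y) by rewrite val_rotate eP.
  by rewrite (twistedP _ _ eP') mulfK ?wk.
have Ral : R \in twisted k al.
  have [T0 TB] := twisted_zmod_closed alE ak al0.
  have -> : R = 0 - (P *~ p + rotate w3 P *~ q).
    by rewrite sub0r; apply/eqP; rewrite -addr_eq0 e.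
  apply: TB => //; pose v (i : 'I_2) := if i == ord0 then P else rotate w3 P.
  pose d (i : 'I_2) := if i == ord0 then p else q.
  have := @zmod_closed_sum _ _ (twisted_zmod_closed alE ak al0) _ v d.
  rewrite !big_ord_recl big_ord0 addr0 /v /d /=; apply => i.
  by case: ifP.
have R3 : R *+ 3 = 0.
  case: (ptP R) => [->|[x [y' [_ eR]]]]; first by rewrite [_ *+ 3]mul0rn.
  move: Rk Ral; rewrite !(twistedP _ _ eR) divr1 => /andP[xk _] /andP[xak _].
  have [x0|x0] := eqVneq x 0; first by apply: (zero_abscissa_3torsion (y := y'));
    rewrite eR x0.
  case/negP: alk; have -> : al = x / (x / al) by field; rewrite al0 x0.
  by rewrite rpred_div.
have c0 i : c i = 0.
  have h : \sum_j Q j *~ (c j * 3%:R) = 0.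
    rewrite -[RHS]R3 /R -sumrMnl; apply: eq_bigr => j _.
    by rewrite mulrzA -pmulrn.
  by have /eqP := Qind _ h i; rewrite mulf_eq0 orbF => /eqP.
have R0 : R = 0 by rewrite /R big1 // => i _; rewrite c0 mulr0z.
move: e; rewrite -/R R0 add0r => /(rotate_independent ws eP al0 free)[-> ->].
by [].
Qed.

End MordellArithmetic.

(** * Simple prime divisors of polynomial values *)

Lemma exists_nat_nonroot (R : numDomainType) (p : {poly R}) : p != 0 ->
  exists n : nat, p.[n%:R] != 0.
Proof.
move=> p0; apply: contrapT => h.
have := @max_poly_roots _ p [seq n%:R | n <- iota 0 (size p)] p0.
rewrite size_map size_iota ltnn => H; suff: false by []; apply: H; last first.
  by rewrite map_inj_uniq ?iota_uniq // => i j /eqP; rewrite eqr_nat => /eqP.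
apply/allP => x /mapP[n _ ->]; apply/rootP/eqP.
by apply: contrapT => /negP hn; apply: h; exists n.
Qed.

Lemma horner_taylor2 (R : comNzRingType) (q : {poly R}) (t h : R) :
  exists s, q.[t + h] = q.[t] + q^`().[t] * h + h ^+ 2 * s.
Proof.
elim/poly_ind: q => [|q c [s IH]]; first by exists 0; rewrite deriv0 !horner0; ring.
exists (s * (t + h) + q^`().[t]).
rewrite derivD derivC derivM derivX !hornerE IH; ring.
Qed.

Section PadicValuation.
Variable p : nat.
Hypothesis p_pr : prime p.

(** The value at 0 is 0, which is why nonvanishing accompanies every valuation below. *)
Definition padic_val (x : rat) : int := (logn p `|numq x|)%:Z - (logn p `|denq x|)%:Z.

Lemma padic_val_frac (m n : int) : m != 0 -> n != 0 ->
  padic_val (m%:~R / n%:~R) = (logn p `|m|)%:Z - (logn p `|n|)%:Z.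
Proof.
move=> m0 n0; rewrite /padic_val; set x := (_ / _).
have x0 : x != 0 by rewrite mulf_neq0 ?invr_eq0 ?intr_eq0.
have : numq x * n = m * denq x.
  apply/eqP; rewrite -(eqr_int rat) !intrM numqE mulrAC.
  by rewrite [x * n%:~R]divfK ?intr_eq0.
move=> /(congr1 absz); rewrite !abszM => /(congr1 (logn p)).
rewrite !lognM ?absz_gt0 ?numq_eq0 ?denq_eq0 // => /(congr1 Posz); rewrite !PoszD.
move: (Posz _) (Posz _) (Posz _) (Posz _) => a b c d e.
by rewrite -[d](addrK c) e; ring.
Qed.

Lemma padic_valM x y : x != 0 -> y != 0 ->
  padic_val (x * y) = padic_val x + padic_val y.
Proof.
move=> x0 y0; rewrite -{1}(divq_num_den x) -{1}(divq_num_den y) mulf_div -!intrM.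
rewrite padic_val_frac ?mulf_neq0 ?numq_eq0 ?denq_eq0 //.
rewrite !abszM !lognM ?absz_gt0 ?numq_eq0 ?denq_eq0 // !PoszD /padic_val; ring.
Qed.

Lemma padic_val1 : padic_val 1 = 0.
Proof. by rewrite /padic_val /= logn1. Qed.

Lemma padic_valX x n : x != 0 -> padic_val (x ^+ n) = padic_val x *+ n.
Proof.
move=> x0; elim: n => [|n IH]; first by rewrite padic_val1.
by rewrite exprS padic_valM ?expf_neq0 // IH mulrS.
Qed.

Lemma padic_val_prod (I : Type) (r : seq I) (F : I -> rat) :
  (forall i, F i != 0) -> padic_val (\prod_(i <- r) F i) = \sum_(i <- r) padic_val (F
    i).
Proof.
move=> F0; elim: r => [|i r IH]; first by rewrite !big_nil padic_val1.
rewrite !big_cons padic_valM ?IH //.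
by elim/big_rec: _ => [|j y _ y0]; rewrite ?oner_eq0 ?mulf_neq0.
Qed.

End PadicValuation.

Lemma prime_gt_notdvd (p : nat) (n : int) : n != 0 -> (`|n| < p)%N -> ~~ (p %| n)%Z.
Proof. by move=> n0 np; rewrite dvdzE; apply/negP => /dvdn_leq;
  rewrite absz_gt0 => /(_ n0); rewrite leqNgt np. Qed.

(** Euclid's argument: with a = q(t0) nonzero, moving t0 by a multiple of a m gives q(t) = a w with
    w = 1 modulo m, so a prime divisor of w is prime to m and exceeds B. *)
Lemma exists_large_prime_divisor (q : {poly int}) (B : nat) : (1 < size q)%N ->
  exists p : nat, [/\ prime p, (B < p)%N & exists t : int, (p %| q.[t])%Z].
Proof.
move=> q1; have q0 : q != 0 by rewrite -size_poly_gt0 ltnW.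
have [t0 a0] := exists_nat_nonroot q0; set a := q.[_] in a0.
(* The 2 ensures m > 1, so that w = 1 modulo m excludes w = 0. *)
pose m : int := ((maxn B 2)`!)%:Z.
have m0 : m != 0 by rewrite eqz_nat -lt0n fact_gt0.
pose l : {poly int} := (a * m) *: 'X + (t0%:R)%:P.
have sl : size l = 2.
  by rewrite size_polyDl size_scale ?mulf_neq0 ?size_polyX // size_polyC; case: eqP.
(* q(t)^2 must differ from a^2 in order that w be neither 1 nor -1. *)
have [j] : exists j : nat, ((q \Po l) ^+ 2 - (a ^+ 2)%:P).[j%:R] != 0.
  apply: exists_nat_nonroot; rewrite subr_eq0; apply/eqP => e.
  have := congr1 (fun p : {poly int} => (size p).-1) e;
    rewrite size_exp size_comp_poly sl muln1.
  by rewrite size_polyC; case: (_ != 0) => /=; case: (size q) q1 => [|[]].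
rewrite !(hornerD, hornerN, hornerC, horner_exp) horner_comp.
set t := l.[j%:R] => aw.
have tE : t = t0%:R + a * (m * j%:R).
  by rewrite /t /l !(hornerD, hornerZ, hornerX, hornerC); ring.
have [s sE] := horner_taylor2 q t0%:R (a * (m * j%:R)).
pose w : int := 1 + m * (q^`().[t0%:R] * j%:R + a * m * j%:R ^+ 2 * s).
have qt : q.[t] = a * w by rewrite tE sE -/a /w; ring.
have w1 : `|w|%N != 1%N.
  apply: contraNneq aw => w1; rewrite qt exprMn.
  have -> : w ^+ 2 = 1 by case: (w) w1 => [[|[|n]]|[|n]].
  by rewrite mulr1 subrr.
have pw := pdiv_dvd `|w|.
have w2 : (1 < `|w|)%N.
  rewrite ltn_neqAle eq_sym w1 absz_gt0; apply/eqP => w0.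
  have : (m %| 1)%Z.
    apply/dvdzP; exists (- (q^`().[t0%:R] * j%:R + a * m * j%:R ^+ 2 * s)).
    by rewrite -[LHS](addrK (m * (q^`().[t0%:R] * j%:R + a * m * j%:R ^+ 2 * s))) -/w
      w0; ring.
  rewrite dvdzE /m /= dvdn1 => /eqP mf; have := fact_geq (maxn B 2).
  by rewrite mf leqNgt leq_maxr.
have p_pr := pdiv_prime w2.
exists (pdiv `|w|); split=> //; last first.
  by exists t; rewrite qt dvdz_mull // dvdzE.
rewrite ltnNge; apply/negP => pB.
have pm : (pdiv `|w| %| m)%Z.
  by rewrite dvdzE dvdn_fact // prime_gt0 //= (leq_trans pB) // leq_maxl.
have wE : w - m * (q^`().[t0%:R] * j%:R + a * m * j%:R ^+ 2 * s) = 1 by rewrite /w;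
  ring.
have : (pdiv `|w| %| w - m * (q^`().[t0%:R] * j%:R + a * m * j%:R ^+ 2 * s))%Z.
  by rewrite rpredB ?dvdz_mulr // dvdzE.
rewrite wE dvdzE absz_nat dvdn1 => /eqP p1.
by move: p_pr; rewrite p1.
Qed.

(** A Bezout relation with cleared denominators shows that a prime p not dividing [N] cannot divide
    both q(t) and q'(t). If p^2 divides q(t0), then q(t0 + p) = q(t0) + p q'(t0) modulo p^2 is
    divisible by p only once. *)
Lemma exists_simple_prime_divisor (f : {poly rat}) (B : nat) :
  (1 < size f)%N -> coprimep f f^`() ->
  exists p : nat, [/\ prime p, (B < p)%N &
    exists t : int, f.[t%:~R] != 0 /\ padic_val p f.[t%:~R] = 1].
Proof.
move=> f1 /Bezout_eq1_coprimepP[[u v] /= uv1].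
have [q [a a0 fq]] := rat_poly_scale f.
have [u' [b b0 uE]] := rat_poly_scale u; have [v' [c c0 vE]] := rat_poly_scale v.
have ev (g : {poly int}) (t : int) : (map_poly intr g : {poly rat}).[t%:~R] = g.[t]%:~R.
  by rewrite horner_map.
have q1 : (1 < size q)%N.
  apply: leq_trans f1 _; rewrite fq; apply: leq_trans (size_scale_leq _ _) _.
  exact: size_poly.
pose N := a * b * c.
have N0 : N != 0 by rewrite !mulf_neq0.
have [p [p_pr pB [t0 pt0]]] := exists_large_prime_divisor (maxn B `|N|) q1.
have pN : ~~ (p %| N)%Z by apply: prime_gt_notdvd => //;
  rewrite (leq_ltn_trans _ pB) // leq_maxr.
have pa : ~~ (p %| a)%Z by apply: contra pN => h; rewrite /N -mulrA dvdz_mulr.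
have bez t : c * u'.[t] * q.[t] + b * v'.[t] * q^`().[t] = N.
  apply/eqP; rewrite -(eqr_int rat) intrD !intrM; apply/eqP.
  have := congr1 (horner^~ t%:~R) uv1.
  rewrite fq derivZ deriv_map uE vE hornerD !hornerM !hornerZ !ev hornerC => e.
  rewrite -[RHS]mulr1 -[X in _ = _ * X]e; field.
  by rewrite !intr_eq0 a0 b0 c0.
have good t : (p %| q.[t])%Z -> ~~ ((p ^ 2)%N %| q.[t])%Z -> exists t : int,
    f.[t%:~R] != 0 /\ padic_val p f.[t%:~R] = 1.
  move=> pq pq2; have qt0 : q.[t] != 0 by apply: contraNneq pq2 => ->; rewrite dvdz0.
  have fE : f.[t%:~R] = q.[t]%:~R / a%:~R by rewrite fq hornerZ ev mulrC.
  exists t; rewrite fE mulf_neq0 ?invr_eq0 ?intr_eq0 //; split=> //.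
  rewrite padic_val_frac //.
  have -> : logn p `|a| = 0%N.
    by apply/eqP; rewrite -[_ == _]negbK -lt0n logn_gt0 mem_primes p_pr absz_gt0 a0.
  suff -> : logn p `|q.[t]| = 1%N by [].
  have h1 : (0 < logn p `|q.[t]|)%N.
    by rewrite logn_gt0 mem_primes p_pr absz_gt0 qt0; exact: pq.
  have h2 : (logn p `|q.[t]| <= 1)%N.
    by rewrite leqNgt -pfactor_dvdn ?absz_gt0 //; exact: pq2.
  by apply/eqP; rewrite eqn_leq h1 h2.
exists p; split=> //; first by rewrite (leq_ltn_trans _ pB) // leq_maxl.
have [p2|p2] := boolP ((p ^ 2)%N %| q.[t0])%Z; last exact: (good t0).
have [s sE] := horner_taylor2 q t0 p%:Z.
have pd : ~~ (p %| q^`().[t0])%Z.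
  apply: contra pN => h; rewrite -(bez t0) rpredD //; exact: dvdz_mull.
apply: (good (t0 + p%:Z)); rewrite sE.
  apply: rpredD; last by rewrite expr2 -mulrA dvdz_mulr.
  by apply: rpredD => //; apply: dvdz_mull.
apply: contra pd => h.
have : ((p ^ 2)%N %| q^`().[t0] * p)%Z.
  have -> : q^`().[t0] * p%:Z = (q.[t0] + q^`().[t0] * p + p%:Z ^+ 2 * s) - q.[t0] -
    p%:Z ^+ 2 * s.
    by ring.
  by rewrite !rpredB // dvdz_mulr // -PoszX.
rewrite !dvdzE abszM /= expnSr dvdn_pmul2r ?prime_gt0 ?expn1 //.
Qed.

(** * Norms and characteristic polynomials *)

Lemma horner_char_poly (R : comNzRingType) n (A : 'M[R]_n) (t : R) :
  (char_poly A).[t] = \det (t%:M - A).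
Proof.
rewrite /char_poly -[_.[t]]/(horner_eval t _) -det_map_mx; congr (\det _).
apply/matrixP => i j; rewrite !mxE /= /horner_eval hornerD hornerN hornerC.
by rewrite hornerMn hornerX.
Qed.

Section DetHorner.
Variables (F : numClosedFieldType) (n : nat) (A : 'M[F]_n.+1) (r : seq F).
Hypothesis rA : char_poly A = \prod_(t <- r) ('X - t%:P).

Lemma size_eigenvalues : size r = n.+1.
Proof. by have := size_char_poly A; rewrite rA size_prod_XsubC => - []. Qed.

(** Both sides are multiplicative in P, which leaves constants and the factors X - s. *)
Lemma det_horner_mx (P : {poly F}) : \det (horner_mx A P) = \prod_(t <- r) P.[t].
Proof.
pose good (p : {poly F}) := \det (horner_mx A p) = \prod_(t <- r) p.[t].
have detM p q : good p -> good q -> good (p * q).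
  rewrite /good => ep eq; rewrite rmorphM /= det_mulmx ep eq -big_split.
  by apply: eq_bigr => t _; rewrite hornerM.
have [rs ->] := closed_field_poly_normal P.
rewrite -/(good _) -mul_polyC; apply: (detM).
  rewrite /good horner_mx_C det_scalar -size_eigenvalues.
  by rewrite (eq_bigr (fun=> lead_coef P)) ?big_const_seq ?count_predT ?iter_mulr_1
    // => t _; rewrite hornerC.
elim/big_ind: _ => [|//|s _].
  by rewrite /good rmorph1 det1 big1 // => t _; exact: hornerC.
rewrite /good.
rewrite rmorphB /= horner_mx_X horner_mx_C.
have -> : A - s%:M = (-1) *: (s%:M - A) by rewrite scaleN1r opprB.
rewrite detZ -horner_char_poly rA horner_prod -size_eigenvalues.
rewrite -[X in X * _](_ : \prod_(t <- r) (-1) = _); last first.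
  by rewrite big_const_seq count_predT iter_mulr_1.
rewrite -big_split; apply: eq_bigr => t _ /=; rewrite !hornerE; ring.
Qed.

Lemma char_poly_horner_mx (q : {poly F}) :
  char_poly (horner_mx A q) = \prod_(t <- r) ('X - (q.[t])%:P).
Proof.
apply/eqP; rewrite -subr_eq0; apply: contraT => /closed_nonrootP[s /negP[]].
rewrite rootE hornerD hornerN horner_char_poly horner_prod.
have -> : s%:M - horner_mx A q = horner_mx A (s%:P - q) by rewrite rmorphB /=
  horner_mx_C.
rewrite det_horner_mx subr_eq0; apply/eqP; apply: eq_bigr => t _.
by rewrite hornerXsubC hornerD hornerN hornerC.
Qed.

End DetHorner.

(** * Multiplication matrices and the norm of a field extension *)

Section RegularRepresentation.
Variables (k : fieldType) (K : fieldExtType k) (n : nat) (b : n.+1.-tuple K).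
Hypothesis bP : basis_of {:K} b.

Definition regmx (a : K) : 'M[k]_n.+1 := \matrix_(i, j) coord b j (a * b`_i).

Lemma regmxE a (i : 'I_n.+1) : a * b`_i = \sum_j regmx a i j *: b`_j.
Proof.
rewrite {1}(coord_basis bP (memvf (a * b`_i))).
by apply: eq_bigr => j _; rewrite mxE.
Qed.

Fact regmx_is_zmod_morphism : zmod_morphism regmx.
Proof. by move=> x y; apply/matrixP => i j; rewrite !mxE mulrBl linearB. Qed.

Fact regmx_is_monoid_morphism : monoid_morphism regmx.
Proof.
split=> [|x y]; apply/matrixP => i j.
  by rewrite !mxE mul1r coord_free ?(basis_free bP) // eq_sym.
rewrite [LHS]mxE [RHS]mxE (mulrC x) -mulrA regmxE.
rewrite mulr_sumr linear_sum; apply: eq_bigr => l _ /=.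
by rewrite -scalerAr linearZ /= [regmx y l j]mxE.
Qed.

HB.instance Definition _ := GRing.isZmodMorphism.Build K 'M[k]_n.+1 regmx
  regmx_is_zmod_morphism.
HB.instance Definition _ := GRing.isMonoidMorphism.Build K 'M[k]_n.+1 regmx
  regmx_is_monoid_morphism.

Lemma regmxB x y : regmx (x - y) = regmx x - regmx y.
Proof. exact: rmorphB. Qed.

Lemma regmx_alg (c : k) : regmx c%:A = c%:M.
Proof.
apply/matrixP => i j; rewrite !mxE -scalerAl mul1r linearZ /=.
by rewrite coord_free ?(basis_free bP) // eq_sym mulr_natr.
Qed.

Lemma regmx_horner (a : K) (q : {poly k}) :
  regmx (map_poly (in_alg K) q).[a] = horner_mx (regmx a) q.
Proof.
elim/poly_ind: q => [|q c IH]; first by rewrite !rmorph0 horner0 rmorph0.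
rewrite !rmorphD !rmorphM /= map_polyX map_polyC /= horner_mx_X horner_mx_C -IH.
by rewrite hornerMXaddC rmorphD rmorphM /= regmx_alg.
Qed.

Lemma regmx_inj : injective regmx.
Proof. exact: fmorph_inj. Qed.

Definition regnorm (a : K) : k := \det (regmx a).

Lemma regnormM : {morph regnorm : x y / x * y}.
Proof. by move=> x y; rewrite /regnorm rmorphM det_mulmx. Qed.

Lemma regnorm1 : regnorm 1 = 1.
Proof. by rewrite /regnorm rmorph1 det1. Qed.

Lemma regnorm_neq0 x : x != 0 -> regnorm x != 0.
Proof.
move=> x0; apply/eqP => e; have := regnormM x x^-1.
by rewrite divff // e mul0r regnorm1 => /eqP; rewrite oner_eq0.
Qed.

Lemma regnormX x m : regnorm (x ^+ m) = regnorm x ^+ m.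
Proof. by elim: m => [|m IH]; rewrite ?regnorm1 // !exprS regnormM IH. Qed.

Lemma regnorm_prod (I : Type) (r : seq I) (F : I -> K) :
  regnorm (\prod_(i <- r) F i) = \prod_(i <- r) regnorm (F i).
Proof. by apply: (big_morph regnorm regnormM regnorm1). Qed.

Lemma regnorm_neq0E x : regnorm x != 0 -> x != 0.
Proof. by apply: contraNneq => ->; rewrite /regnorm rmorph0 det0. Qed.

(** The characteristic polynomial kills [th], and a generator is killed by no nonzero polynomial of
    smaller degree. A nontrivial common factor with the derivative would split it into two factors
    of smaller degree, one of which kills [th]. *)
Lemma separable_char_poly_generator (th : K) : <<1; th>>%VS = {:K}%VS ->
  [pchar k] =i pred0 -> separable_poly (char_poly (regmx th)).
Proof.
move=> gen ch0; set chi := char_poly _.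
have sz_chi : size chi = n.+2 by rewrite size_char_poly.
have dimK : \dim {:K} = n.+1.
  by have /andP[/eqP <- /eqnP ->] := bP; apply: size_tuple.
have ann (q : {poly k}) : q != 0 -> (map_poly (in_alg K) q).[th] = 0 ->
  (n.+1 < size q)%N.
  move=> q0 qth; have := @minPoly_dvdp _ _ 1%AS th (map_poly (in_alg K) q).
  rewrite alg_polyOver rootE qth eqxx => /(_ isT isT) /dvdp_leq.
  rewrite map_poly_eq0 q0 size_minPoly size_map_poly => /(_ isT).
  by have := dim_Fadjoin 1%AS th; rewrite gen dimK dimv1 muln1 => <-.
have chi_th : (map_poly (in_alg K) chi).[th] = 0.
  by apply: regmx_inj; rewrite regmx_horner Cayley_Hamilton rmorph0.
have chi0 : chi != 0 by rewrite -size_poly_gt0 sz_chi.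
rewrite separable_poly.unlock; apply: contraT => ncop.
pose g := gcdp chi chi^`(); pose h := chi %/ g.
have chiE : chi = h * g by rewrite divpK // dvdp_gcdl.
have dchi0 : chi^`() != 0.
  have : chi^`()`_n != 0.
    rewrite coef_deriv -[n.+1]/(n.+2.-1) -sz_chi -lead_coefE (monicP (char_poly_monic
      _)) sz_chi /=.
    by have /pcharf0P := ch0 => ->.
  by apply: contraNneq => ->; rewrite coef0.
have g0 : g != 0 by rewrite gcdp_eq0 negb_and chi0.
have h0 : h != 0 by apply: contraNneq chi0 => h0; rewrite chiE h0 mul0r.
have sg : (size g < n.+2)%N.
  rewrite -sz_chi; apply: leq_ltn_trans (lt_size_deriv chi0).
  by apply: dvdp_leq => //; apply: dvdp_gcdr.
have sh : (size h < n.+2)%N.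
  have sg2 : (1 < size g)%N.
    by rewrite ltn_neqAle eq_sym ncop size_poly_gt0.
  by rewrite -sz_chi chiE size_mul // -[size g](prednK (ltnW sg2)) addnS /=
    -ltn_subLR // subnn -ltnS prednK // ltnW.
move/eqP: chi_th; rewrite chiE rmorphM hornerM mulf_eq0 => /orP[] /eqP /ann.
  by rewrite h0 => /(_ isT); rewrite ltnNge -ltnS sh.
by rewrite g0 => /(_ isT); rewrite ltnNge -ltnS sg.
Qed.

End RegularRepresentation.

(** * Independent cube classes *)

Section NumberFieldTwist.

Variable K : fieldExtType rat.

Lemma exists_basis : exists n (b : n.+1.-tuple K), basis_of {:K} b.
Proof.
have : (0 < \dim {:K})%N by rewrite adim_gt0.
have := vbasisP {:K}; case: (\dim {:K}) (vbasis _) => // n b bP _.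
by exists n, b.
Qed.

Lemma exists_generator : exists th : K, <<1; th>>%VS = {:K}%VS.
Proof.
have sep : separable 1 {:K}.
  apply/separableP => x _; apply: pcharf0_separable => p.
  by rewrite pchar_lalg pchar_num.
by exists (separable_generator 1 {:K}); rewrite -eq_adjoin_separable_generator ?sub1v.
Qed.

Variables (n : nat) (b : n.+1.-tuple K).
Hypothesis bP : basis_of {:K} b.

(* The conjugates of [D (th + m)^6] are distinct for all but finitely many [m]. *)
Lemma exists_separable_twist (D : K) : D != 0 -> exists2 u : K, u != 0 &
  separable_poly (char_poly (regmx b (D * u ^+ 6))).
Proof.
move=> D0; have [th gen] := exists_generator.
have [d dE] : exists d, D = (map_poly (in_alg K) d).[th].
  by apply/Fadjoin1_polyP; rewrite gen memvf.
set A := regmx b th.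
pose toC : {rmorphism rat -> algC} := ratr.
pose AC := map_mx toC A.
have [r rA] : exists r : seq algC, char_poly AC = \prod_(t <- r) ('X - t%:P).
  have [r e] := closed_field_poly_normal (char_poly AC); exists r.
  by rewrite [LHS]e (monicP (char_poly_monic _)) scale1r.
have sepA : separable_poly (char_poly A).
  by apply: separable_char_poly_generator => // p; rewrite pchar_num.
have r_uniq : uniq r.
  by rewrite -separable_prod_XsubC -rA -map_char_poly separable_map.
have normE (q : {poly rat}) :
    toC (regnorm b (map_poly (in_alg K) q).[th]) = \prod_(t <- r) (map_poly toC q).[t].
  by rewrite /regnorm (regmx_horner bP) -det_map_mx map_horner_mx (det_horner_mx rA).
have charE (q : {poly rat}) : map_poly toC (char_poly (regmx b (map_poly (in_alg K)
  q).[th]))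
    = \prod_(t <- r) ('X - (map_poly toC q).[t]%:P).
  by rewrite (regmx_horner bP) map_char_poly map_horner_mx (char_poly_horner_mx rA).
pose dC := map_poly toC d.
have d0 t : t \in r -> dC.[t] != 0.
  move=> tr; have : toC (regnorm b D) != 0 by rewrite fmorph_eq0 (regnorm_neq0 bP).
  by rewrite dE normE prodf_seq_neq0 => /allP/(_ _ tr).
(* [tw t] is the conjugate of D (th + X)^6 attached to the conjugate [t] of [th]. In [bad], the
   first product guards against th + m = 0 and the second against coinciding conjugates. *)
pose tw t : {poly algC} := dC.[t] *: ('X + t%:P) ^+ 6.
pose bad : {poly algC} := (\prod_(t <- r) ('X + t%:P)) *
  \prod_(t <- r) \prod_(s <- r | s != t) (tw t - tw s).
have bad0 : bad != 0.
  rewrite mulf_neq0 //.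
    by rewrite prodf_seq_neq0; apply/allP => t _;
      rewrite -[t]opprK polyCN polyXsubC_eq0.
  rewrite prodf_seq_neq0; apply/allP => t tr /=.
  rewrite prodf_seq_neq0; apply/allP => s sr /=; apply/implyP => st.
  (* At [- t] the term [tw t] vanishes, while [tw s] does not. *)
  apply/eqP => /(congr1 (horner^~ (- t))) /eqP.
  rewrite /tw hornerD hornerN !hornerZ !horner_exp !hornerD !hornerX !hornerC ?horner0.
  rewrite addNr expr0n mulr0 sub0r oppr_eq0 mulf_eq0 (negPf (d0 _ sr)) expf_eq0 /=.
  by rewrite addrC subr_eq0 (negPf st).
have [m] := exists_nat_nonroot bad0; rewrite /bad hornerM mulf_eq0 negb_or !horner_prod.
rewrite !prodf_seq_neq0 => /andP[/allP m1 /allP m2].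
pose lin : {poly rat} := 'X + m%:R%:P.
have linC : map_poly toC lin = 'X + m%:R%:P.
  by rewrite rmorphD /= map_polyX map_polyC /= ratr_nat.
have linE : (map_poly (in_alg K) lin).[th] = th + m%:R.
  by rewrite rmorphD /= map_polyX map_polyC /= hornerD hornerX hornerC scaler_nat.
have duE : D * (th + m%:R) ^+ 6 = (map_poly (in_alg K) (d * lin ^+ 6)).[th].
  by rewrite rmorphM rmorphXn hornerM horner_exp linE -dE.
exists (th + m%:R).
  apply: (regnorm_neq0E bP); rewrite -(fmorph_eq0 toC) -linE normE.
  rewrite prodf_seq_neq0; apply/allP => t tr /=; rewrite linC.
  by have := m1 _ tr; rewrite /= !hornerD !hornerX !hornerC addrC.
rewrite duE -(separable_map toC) charE.
have -> : \prod_(t <- r) ('X - (map_poly toC (d * lin ^+ 6)).[t]%:P) =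
  \prod_(t <- [seq (tw t).[m%:R] | t <- r]) ('X - t%:P).
  rewrite big_map; apply: eq_bigr => t _; congr ('X - _%:P).
  rewrite rmorphM rmorphXn /= linC /tw hornerM hornerZ !horner_exp !hornerD !hornerX
    !hornerC.
  by rewrite [m%:R + _]addrC.
rewrite separable_prod_XsubC map_inj_in_uniq // => t s tr sr ets; apply/eqP.
apply: contraT => ts; have := m2 _ tr; rewrite /= horner_prod prodf_seq_neq0.
by move=> /allP/(_ _ sr)/implyP; rewrite eq_sym ts hornerD hornerN ets subrr eqxx =>
  /(_ isT).
Qed.

(* The norm of [(t + s)^2 - d] is the value at [t] of a separable polynomial,
   so it is exactly divisible by arbitrarily large primes. *)
Lemma exists_new_cube_class (d : K) (s : rat) : d != 0 ->
  separable_poly (char_poly (regmx b d)) -> forall r : seq K, (forall x,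
    x \in r -> x != 0) ->
  exists t : int, let a := ((t%:~R + s) ^+ 2)%:A - d in a != 0 /\
   forall (c : K) (e : nat -> nat), a != c ^+ 3 * \prod_(i < size r) r`_i ^+ e i.
Proof.
move=> d0 sep r r0; set chi := char_poly _ in sep.
pose h : {poly rat} := ('X + s%:P) ^+ 2; pose f := chi \Po h.
have XsE : 'X + s%:P = 'X - (- s)%:P by rewrite polyCN opprK.
have sh : size h = 3 by rewrite /h XsE size_exp_XsubC.
have chi1 : size chi = n.+2 by rewrite size_char_poly.
have sf : (1 < size f)%N.
  have := size_comp_poly chi h; rewrite -/f sh chi1 /= => e.
  by case: (size f) e => [|[|]] //=; rewrite mulSn addnC addnS.
have chi0 : chi.[0] != 0.
  rewrite horner_char_poly -(regmx_alg bP) -(regmxB bP) scale0r sub0r.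
  by rewrite (regnorm_neq0 bP) // oppr_eq0.
(* f' = chi'(h) h'. The first factor is coprime to chi(h), and h' vanishes only at [- s], where f
   takes the value chi(0), up to sign the norm of [d]. *)
have cop : coprimep f f^`().
  have cc : coprimep chi chi^`() by move: sep; rewrite separable_poly.unlock.
  rewrite /f deriv_comp coprimepMr coprimep_comp_poly //=.
  have -> : h^`() = 2%:R *: ('X - (- s)%:P).
    by rewrite /h deriv_exp derivD derivX derivC addr0 mul1r expr1 -XsE scaler_nat.
  rewrite coprimepZr ?pnatr_eq0 // coprimep_XsubC rootE horner_comp.
  by rewrite /h horner_exp hornerD hornerX hornerC addNr expr0n.
have fE t : f.[t] = regnorm b (((t + s) ^+ 2)%:A - d).
  by rewrite /f horner_comp horner_char_poly /h horner_exp hornerD hornerX hornerC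
    /regnorm (regmxB bP) (regmx_alg bP).
(* A prime above [B] has valuation 0 at the norms of all the elements of [r]. *)
pose B := \max_(x <- r) maxn `|numq (regnorm b x)| `|denq (regnorm b x)|.
have [p [p_pr pB [t [ft0 ft]]]] := exists_simple_prime_divisor B sf cop.
exists t => a; rewrite fE -/a in ft ft0.
split; first exact: (regnorm_neq0E bP ft0).
move=> c e; apply/eqP => ae.
have nu x : x \in r -> padic_val p (regnorm b x) = 0.
  move=> xr; have xB : (maxn `|numq (regnorm b x)| `|denq (regnorm b x)| < p)%N.
    by apply: leq_ltn_trans pB; apply: (leq_bigmax_seq (F := fun x => maxn _ _)).
  by move: xB; rewrite gtn_max => /andP[x1 x2]; rewrite /padic_val !ltn_log0.
have c0 : c != 0.
  by apply: contraNneq (regnorm_neq0E bP ft0) => c0; rewrite ae c0 expr0n mul0r.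
have ri0 (i : 'I_(size r)) : r`_i != 0 by rewrite r0 // mem_nth.
have Ni0 (i : 'I_(size r)) : regnorm b (r`_i ^+ e i) != 0.
  by rewrite (regnorm_neq0 bP) ?expf_neq0.
(* The contradiction: the left side is 1 by the choice of [p]. *)
have : padic_val p (regnorm b a) = padic_val p (regnorm b c) *+ 3.
  rewrite ae (regnormM bP) (regnormX bP) (regnorm_prod bP) padic_valM //; last first.
  - by apply/prodf_neq0 => i _.
  - by rewrite expf_neq0 // (regnorm_neq0 bP).
  rewrite padic_valX ?(regnorm_neq0 bP) // padic_val_prod // big1 ?addr0 // => i _.
  by rewrite (regnormX bP) padic_valX ?(regnorm_neq0 bP) // nu ?mul0rn ?mem_nth.
rewrite ft => /esym e3; have : (3%:Z %| padic_val p (regnorm b c) *+ 3)%Z.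
  by apply/dvdzP; exists (padic_val p (regnorm b c)); rewrite -mulr_natr.
by rewrite e3.
Qed.

End NumberFieldTwist.

(** * Kummer towers *)

Section CubicSpan.

Variables (F : numFieldType) (S : divringClosed F) (a al z : F).
Hypotheses (alE : al ^+ 3 = a) (aS : a \in S).
Hypotheses (zS : z \in S) (zP : 3.-primitive_root z).

(** [V] is a bare predicate so that [tower] can be defined by recursion before its levels are known
    to be fields. *)
Definition cubic_span (V : {pred F}) (t : F) : {pred F} := fun w =>
  `[< exists c : F * F * F, [/\ c.1.1 \in V, c.1.2 \in V, c.2 \in V
      & w = c.1.1 + c.1.2 * t + c.2 * t ^+ 2] >].

Lemma cubic_spanP w : reflect (exists c : F * F * F,
    [/\ c.1.1 \in S, c.1.2 \in S, c.2 \in S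
      & w = c.1.1 + c.1.2 * al + c.2 * al ^+ 2]) (w \in cubic_span S al).
Proof. exact: asboolP. Qed.

Lemma sub_cubic_span w : w \in S -> w \in cubic_span S al.
Proof.
move=> wS; apply/cubic_spanP; exists (w, 0, 0); rewrite /= !rpred0.
by split=> //; ring.
Qed.

Lemma cube_root_mem c : c \in S -> c ^+ 3 = a -> al \in S.
Proof.
move=> cS ca; have [c0|c0] := eqVneq c 0.
  move: alE; rewrite -ca c0 expr0n /= => /eqP.
  by rewrite expf_eq0 /= => /eqP ->; rewrite rpred0.
have /(prim_rootP zP)[i ei] : (al / c) ^+ 3 = 1.
  by rewrite expr_div_n alE ca divff // -ca expf_neq0.
by rewrite -[al](divfK c0) ei rpredM // rpredX.
Qed.

(** If al^2 = p al + q, then al^3 = a yields (p q - a) + (p^2 + q) al = 0. Hence q = - p^2 and a =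
    (- p)^3, and since S contains the cube roots of unity, [al] would lie in S. *)
Lemma cubic_independent c0 c1 c2 : al \notin S ->
  c0 \in S -> c1 \in S -> c2 \in S -> c0 + c1 * al + c2 * al ^+ 2 = 0 ->
  [/\ c0 = 0, c1 = 0 & c2 = 0].
Proof.
move=> alS h0 h1 h2 e.
have lin b0 b1 : b0 \in S -> b1 \in S -> b0 + b1 * al = 0 -> b0 = 0 /\ b1 = 0.
  move=> k0 k1 eb; have [b10|b10] := eqVneq b1 0.
    by move: eb; rewrite b10 mul0r addr0.
  case/negP: alS; suff -> : al = - b0 / b1 by rewrite rpred_div ?rpredN.
  by apply: (mulfI b10); rewrite mulrCA divff // mulr1; apply/eqP;
    rewrite -addr_eq0 addrC eb.
have [c20|c20] := eqVneq c2 0.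
  by move: e; rewrite c20 mul0r addr0 => /(lin _ _ h0 h1) [].
pose p := - c1 / c2; pose q := - c0 / c2.
have pS : p \in S by rewrite rpred_div ?rpredN.
have qS : q \in S by rewrite rpred_div ?rpredN.
have al2 : al ^+ 2 = p * al + q.
  apply: (mulfI c20); apply/eqP; rewrite -subr_eq0 /p /q; apply/eqP.
  by rewrite -[RHS]e; field.
clearbody p q.
have : (p * q - a) + (p ^+ 2 + q) * al = 0.
  transitivity (p * (p * al + q) + q * al - a); first by ring.
  rewrite -al2 -alE; transitivity (al * (p * al + q) - al ^+ 3); first by ring.
  by rewrite -al2; ring.
case/lin; rewrite ?(rpredD, rpredN, rpredM, rpredX) //.
move=> /subr0_eq pq pp; case/negP: alS; apply: (@cube_root_mem (- p)).
  by rewrite rpredN.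
by rewrite -pq -[q](addrK (p ^+ 2)) [q + _]addrC pp; ring.
Qed.

Lemma cubic_span_closed : divring_closed (cubic_span S al).
Proof.
have mulS u v : u \in cubic_span S al -> v \in cubic_span S al ->
  u * v \in cubic_span S al.
  move=> /cubic_spanP[[[c0 c1] c2] /= [h0 h1 h2 ->]] /cubic_spanP[[[d0 d1] d2] /= [k0
    k1 k2 ->]].
  apply/cubic_spanP; exists (c0 * d0 + a * (c1 * d2 + c2 * d1),
    c0 * d1 + c1 * d0 + a * (c2 * d2), c0 * d2 + c1 * d1 + c2 * d0).
  rewrite /= -alE; split; rewrite ?alE; try by rewrite !(rpredD, rpredM).
  by rewrite -alE; ring.
split; first by rewrite sub_cubic_span ?rpred1.
  move=> u v /cubic_spanP[[[c0 c1] c2] /= [h0 h1 h2 ->]] /cubic_spanP[[[d0 d1] d2] /=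
    [k0 k1 k2 ->]].
  apply/cubic_spanP; exists (c0 - d0, c1 - d1, c2 - d2).
  by split; rewrite /= ?rpredB //; ring.
move=> u v hu hv; apply: mulS => //.
case/cubic_spanP: hv => [[[c0 c1] c2] /= [h0 h1 h2 e]].
have [v0|v0] := eqVneq v 0; first by rewrite v0 invr0 sub_cubic_span ?rpred0.
have [alS|alS] := boolP (al \in S).
  by rewrite sub_cubic_span // rpredV e !(rpredD, rpredM) // rpredX.
(* [w] is the product of the two other conjugates of [v], and [nm] is the norm. *)
pose d0 := c0 ^+ 2 - a * c1 * c2; pose d1 := a * c2 ^+ 2 - c0 * c1;
  pose d2 := c1 ^+ 2 - c0 * c2.
have k0 : d0 \in S by rewrite rpredB ?rpredM ?rpredX.
have k1 : d1 \in S by rewrite rpredB ?rpredM ?rpredX.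
have k2 : d2 \in S by rewrite rpredB ?rpredM ?rpredX.
pose w := d0 + d1 * al + d2 * al ^+ 2.
pose nm := c0 ^+ 3 + a * c1 ^+ 3 + a ^+ 2 * c2 ^+ 3 - 3%:R * a * c0 * c1 * c2.
have vw : v * w = nm by rewrite e /w /d0 /d1 /d2 /nm -alE; ring.
have nmS : nm \in S by rewrite ?(rpred_nat, rpredX, rpredM, rpredB, rpredD).
have nm0 : nm != 0.
  apply/eqP => nm0; move/eqP: vw; rewrite nm0 mulf_eq0 (negPf v0) /= => /eqP.
  case/(cubic_independent alS k0 k1 k2) => e0 e1 e2.
  have [c20|c20] := eqVneq c2 0.
    move: e0 e2 v0; rewrite /d0 /d2 c20 !mulr0 !subr0 e => /eqP.
    rewrite expf_eq0 /= => /eqP -> /eqP; rewrite expf_eq0 /= => /eqP ->.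
    by rewrite c20 !mul0r !addr0 eqxx.
  case/negP: alS; apply: (@cube_root_mem (c1 / c2)); first by rewrite rpred_div.
  rewrite expr_div_n; apply: (mulIf (expf_neq0 3 c20)); rewrite divfK ?expf_neq0 //.
  have -> : c1 ^+ 3 = c1 * d2 - c2 * d1 + a * c2 ^+ 3 by rewrite /d1 /d2; ring.
  by rewrite e1 e2; ring.
have -> : v^-1 = w / nm by apply: (mulfI v0); rewrite divff // mulrA vw divff.
rewrite /w; apply/cubic_spanP; exists (d0 / nm, d1 / nm, d2 / nm).
by split; rewrite /= ?rpred_div //; field.
Qed.

(** One step of Kummer theory by expansion instead of Galois action. The coefficients of al and al^2
    in w^3 vanish, and eliminating between them gives c0 (a c2^3 - c1^3) = 0. As a is no cube in S,
    at most one of c0, c1, c2 survives. *)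
Lemma cube_in_cubic_span b w : b \in S -> w \in cubic_span S al -> w ^+ 3 = b ->
  exists2 c, c \in S & exists i : nat, b = c ^+ 3 * a ^+ i.
Proof.
move=> bS /cubic_spanP[[[c0 c1] c2] /= [h0 h1 h2 e]] wb.
have [alS|alS] := boolP (al \in S).
  exists w; last by exists 0%N; rewrite mulr1.
  by rewrite e !(rpredD, rpredM) // rpredX.
pose d0 := c0 ^+ 3 + a * c1 ^+ 3 + a ^+ 2 * c2 ^+ 3 + 6%:R * a * c0 * c1 * c2 - b.
pose d1 := 3%:R * (c0 ^+ 2 * c1 + a * c1 ^+ 2 * c2 + a * c0 * c2 ^+ 2).
pose d2 := 3%:R * (c0 ^+ 2 * c2 + c0 * c1 ^+ 2 + a * c1 * c2 ^+ 2).
have : d0 + d1 * al + d2 * al ^+ 2 = 0.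
  by rewrite /d0 /d1 /d2 -wb e -alE; ring.
case/(cubic_independent alS); rewrite ?(rpred_nat, rpredX, rpredM, rpredB, rpredD) //.
have n3 : (3%:R : F) != 0 by rewrite pnatr_eq0.
move=> e0 /eqP; rewrite mulf_eq0 (negPf n3) /= => /eqP e1 /eqP;
  rewrite mulf_eq0 (negPf n3) /= => /eqP e2.
have : c0 * (a * c2 ^+ 3 - c1 ^+ 3) = 0.
  transitivity (c2 * (c0 ^+ 2 * c1 + a * c1 ^+ 2 * c2 + a * c0 * c2 ^+ 2) -
     c1 * (c0 ^+ 2 * c2 + c0 * c1 ^+ 2 + a * c1 * c2 ^+ 2)); first by ring.
  by rewrite e1 e2 !mulr0 subr0.
move/eqP; rewrite mulf_eq0 => /orP[/eqP c00|].
  move/eqP: e1; rewrite c00 expr0n /= mul0r add0r mulr0 mul0r addr0 !mulf_eq0.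
  rewrite orbb; case/orP=> [/orP[] /eqP h|/eqP h].
  - exists w; last by exists 0%N; rewrite mulr1.
    case/negP: alS; have /eqP := alE; rewrite h expf_eq0 /= => /eqP ->; exact: rpred0.
  - exists c2 => //; exists 2; move: e0; rewrite /d0 c00 h => e0.
    by apply/eqP; rewrite -subr_eq0 -oppr_eq0; apply/eqP; rewrite -[RHS]e0; ring.
  - exists c1 => //; exists 1%N; move: e0; rewrite /d0 c00 h => e0.
    by apply/eqP; rewrite -subr_eq0 -oppr_eq0; apply/eqP; rewrite -[RHS]e0; ring.
have [c20|c20] := eqVneq c2 0.
  rewrite c20 expr0n /= mulr0 sub0r oppr_eq0 expf_eq0 /= => /eqP c10.
  exists c0 => //; exists 0%N; move: e0; rewrite /d0 c10 c20 => e0.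
  by apply/eqP; rewrite -subr_eq0 -oppr_eq0; apply/eqP; rewrite -[RHS]e0; ring.
rewrite subr_eq0 => /eqP h.
case/negP: alS; apply: (@cube_root_mem (c1 / c2)); first by rewrite rpred_div.
by rewrite expr_div_n -h mulfK // expf_neq0.
Qed.

End CubicSpan.

(** * Towers of cubic radical extensions *)

Section KummerTower.

Variables (F : numFieldType) (k : divringClosed F) (a al : nat -> F) (z : F).
Hypotheses (alE : forall i, al i ^+ 3 = a i) (ak : forall i, a i \in k).
Hypotheses (a_neq0 : forall i, a i != 0).
Hypotheses (zk : z \in k) (zP : 3.-primitive_root z).

Fixpoint tower n : {pred F} :=
  if n is n'.+1 then cubic_span (tower n') (al n') else k.

Lemma tower_base n : divring_closed (tower n) /\ {subset k <= tower n}.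
Proof.
elim: n => [|n [cl sub]].
  by split=> //; split=> [|x y|x y]; rewrite ?rpred1 //;
    [exact: rpredB | exact: rpred_div].
pose S : divringClosed F := HB.pack (tower n : F ->
  bool) (GRing.isDivringClosed.Build F (tower n) cl).
split; first exact: (@cubic_span_closed _ S _ _ z (alE n) (sub _ (ak n)) (sub _ zk) zP).
by move=> x /sub xS; apply: (@sub_cubic_span _ S).
Qed.

Definition tower_field n : divringClosed F :=
  HB.pack (tower n : F -> bool) (GRing.isDivringClosed.Build F (tower n) (tower_base
    n).1).

Lemma base_sub_tower n : {subset k <= tower_field n}.
Proof. exact: (tower_base n).2. Qed.

Lemma cubic_span_sub_tower i n : (i < n)%N ->
  {subset cubic_span k (al i) <= tower_field n}.
Proof.
move=> ltin x xi; have : x \in tower i.+1.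
  case/cubic_spanP: xi => c [h0 h1 h2 ->].
  by apply/(@cubic_spanP _ (tower_field i)); exists c; split; rewrite ?base_sub_tower.
rewrite -[n](subnKC ltin); elim: (n - i.+1)%N => [|m IH]; first by rewrite addn0.
by move/IH => xm; rewrite addnS; apply: (@sub_cubic_span _ (tower_field (i.+1 + m))).
Qed.

Lemma cube_in_tower n b w : b \in k -> w \in tower_field n -> w ^+ 3 = b ->
  exists2 c, c \in k & exists e : nat -> nat, b = c ^+ 3 * \prod_(i < n) a i ^+ e i.
Proof.
elim: n b w => [|n IH] b w bk wS wb.
  by exists w => //; exists (fun=> 0%N); rewrite big_ord0 mulr1.
have aS := base_sub_tower n (ak n).
have [c cS [i bE]] := @cube_in_cubic_span _ (tower_field n) _ _ z (alE n) aS
  (base_sub_tower n zk) zP b w (base_sub_tower n bk) wS wb.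
have bk' : b / a n ^+ i \in k by rewrite rpred_div ?rpredX.
have cb : c ^+ 3 = b / a n ^+ i by rewrite bE mulfK // expf_neq0.
have [d dk [e de]] := IH _ _ bk' cS cb.
exists d => //; exists (fun j => if j == n then i else e j).
rewrite big_ord_recr /= eqxx mulrA (eq_bigr (fun j : 'I_n => a j ^+ e j)) => [|j _].
  by rewrite -de divfK // expf_neq0.
by rewrite ltn_eqF.
Qed.

(** The compositum lies in [tower_field n], which does not contain [al n], by [cube_in_tower]. Hence
    1, al, al^2 stay independent over it, and a relation among the [v j] splits into three relations
    among their coordinates, which form a matrix over K. *)
Lemma tower_linearly_disjoint (K : fieldType) (iota : {rmorphism K -> F})
    (A : nat -> F -> Prop) :
  (forall x, image_of iota x <-> x \in k) ->
  (forall i x, A i x -> x \in cubic_span k (al i)) ->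
  (forall n c (e : nat -> nat), c \in k -> a n != c ^+ 3 * \prod_(i < n) a i ^+ e i) ->
  linearly_disjoint_seq (image_of iota) A.
Proof.
move=> kP AP indep n m v Av vfree c cS cv.
have cT j : c j \in tower_field n.
  apply: cS; first exact: (tower_base n).1.
    by move=> x /kP /base_sub_tower.
  by move=> j' x ltj /AP; apply: cubic_span_sub_tower.
have alS : al n \notin tower_field n.
  apply/negP => alS; have [d dk [e de]] := cube_in_tower (ak n) alS (alE n).
  by have := indep n d e dk; rewrite -de eqxx.
have /choice[M MP] j : exists q : 'I_3 -> K, v j = \sum_(l < 3) iota (q l) * al n ^+ l.
  have /cubic_spanP[q [/kP[q0 e0] /kP[q1 e1] /kP[q2 e2] ->]] := AP _ _ (Av j).
  exists (fun l => nth 0 [:: q0; q1; q2] l).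
  by rewrite !big_ord_recl big_ord0 /= /bump /= e0 e1 e2; ring.
pose W := \matrix_(j < m, l < 3) M j l.
have freeW : row_free W.
  rewrite -kermx_eq0; apply/eqP/row_matrixP => r; rewrite row0; apply/rowP => j.
  rewrite [RHS]mxE; apply: (fmorph_inj iota); rewrite rmorph0.
  apply: (vfree (fun j => iota (row r (kermx W) 0 j))) => [l|]; first by eexists.
  have e0 : row r (kermx W) *m W = 0 by rewrite -row_mul mulmx_ker row0.
  under eq_bigr => l _ do rewrite MP mulr_sumr.
  rewrite exchange_big big1 // => l _; under eq_bigr => h _ do rewrite mulrA -rmorphM.
  have /matrixP/(_ 0 l) := e0; rewrite [in LHS]mxE [RHS]mxE => {}e0.
  rewrite -mulr_suml -rmorph_sum (_ : \sum_h _ = 0) ?rmorph0 ?mul0r //.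
  by rewrite -[RHS]e0; apply: eq_bigr => h _; rewrite [W h l]mxE.
have sum0 l : \sum_j c j * iota (M j l) = 0.
  have in_k x : iota x \in k by apply/kP; exists x.
  have inT l' : \sum_j c j * iota (M j l') \in tower_field n.
    by apply: rpred_sum => j _; rewrite rpredM // base_sub_tower.
  have : \sum_(l' < 3) (\sum_j c j * iota (M j l')) * al n ^+ l' = 0.
    rewrite -[RHS]cv; under eq_bigr => l' _ do rewrite mulr_suml.
    rewrite exchange_big; apply: eq_bigr => j _; rewrite MP mulr_sumr.
    by apply: eq_bigr => l' _; rewrite mulrA.
  rewrite !big_ord_recl big_ord0 /bump /= addr0 mulr1 expr1 addrA.
  case/(@cubic_independent _ (tower_field n) _ _ z (alE n) (base_sub_tower n (ak n))
    (base_sub_tower n zk) zP) => //.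
  case: l => [[|[|[|//]]] h] s0 s1 s2; [rewrite -[RHS]s0 | rewrite -[RHS]s1 | rewrite
    -[RHS]s2];
    by apply: eq_bigr => j _; congr (_ * iota (M j _)); apply: val_inj.
(* A right inverse over K carries the independence of the rows over to [F]. *)
have /row_freeP[N WN] := freeW.
have cW : (\row_j c j) *m map_mx iota W = 0.
  apply/rowP => l; rewrite !mxE -[RHS](sum0 l); apply: eq_bigr => j _.
  by rewrite !mxE.
move=> i; have /matrixP/(_ 0 i) : \row_j c j = 0 :> 'rV[F]_m.
  by rewrite -[LHS]mulmx1 -(map_mx1 iota) -WN map_mxM mulmxA cW mul0mx.
by rewrite !mxE.
Qed.

End KummerTower.

(** * Cyclic cubic extensions *)

Lemma cube_polynomial_splits (K : fieldType) (L : fieldExtType K) (z a : K) (rt : L) :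
  3.-primitive_root z -> rt ^+ 3 = a%:A -> rt != 0 ->
  (forall x, exists q, x = (map_poly (in_alg L) q).[rt]) ->
  exists p : {poly L}, [/\ p \is a polyOver 1%VS, separable_poly p
                         & splittingFieldFor 1 p {:L}].
Proof.
move=> zP rt3 rt0 gen; have [zs z3] := prim3_sum zP.
have [zA [zA1 zA3 zAs]] : exists zA : L, [/\ zA != 1,
  zA ^+ 3 = 1 & 1 + zA + zA ^+ 2 = 0].
  exists (in_alg L z); rewrite -rmorphXn z3 rmorph1; split=> //.
    rewrite -[X in _ != X](rmorph1 (in_alg L)) fmorph_eq; apply/eqP => z1.
    by have := prim_order_dvd zP 1; rewrite expr1 z1 eqxx.
  by rewrite -rmorphXn -(rmorph1 (in_alg L)) -!rmorphD zs rmorph0.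
pose rs := [:: rt; zA * rt; zA ^+ 2 * rt].
have pE : 'X^3 - (a%:A)%:P = \prod_(x <- rs) ('X - x%:P).
  rewrite !big_cons big_nil mulr1 -rt3 (polyCM zA) (polyCM (zA ^+ 2)) !polyC_exp.
  have e1 : 1 + zA%:P + zA%:P ^+ 2 = 0 :> {poly L}.
    by rewrite -polyC1 -polyC_exp -!polyCD zAs.
  have e3 : zA%:P ^+ 3 = 1 :> {poly L} by rewrite -polyC_exp zA3.
  move: (zA%:P) (rt%:P) e1 e3 => Z T e1 e3.
  transitivity ('X^3 - (1 + Z + Z ^+ 2) * T * 'X^2
    + Z * (1 + Z + Z ^+ 2) * T ^+ 2 * 'X - Z ^+ 3 * T ^+ 3).
    by rewrite e1 e3; ring.
  by ring.
exists ('X^3 - (a%:A)%:P); split.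
- by rewrite rpredB ?rpredX ?polyOverX // polyOverC rpredZ // rpred1.
- rewrite pE separable_prod_XsubC /= !inE !negb_or.
  have zA0 : zA != 0 by apply: contra_eq_neq zA3 => ->; rewrite expr0n eq_sym oner_eq0.
  have zA2 : zA ^+ 2 != 1.
    by apply: contra_neq zA1 => z2; rewrite -zA3 exprS z2 mulr1.
  have mulrt x y : (x * rt == y * rt) = (x == y) by rewrite (inj_eq (mulIf rt0)).
  have -> : rt == zA * rt = (1 == zA) by rewrite -mulrt mul1r.
  have -> : rt == zA ^+ 2 * rt = (1 == zA ^+ 2) by rewrite -mulrt mul1r.
  rewrite mulrt ![1 == _]eq_sym zA1 zA2 /= andbT.
  by rewrite expr2 -{1}[zA]mul1r (inj_eq (mulIf zA0)) eq_sym zA1.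
exists rs; first by rewrite pE eqpxx.
apply/vspaceP => x; rewrite memvf; have [q ->] := gen x.
have rtin : rt \in <<1 & rs>>%VS by apply: seqv_sub_adjoin; rewrite inE eqxx.
apply: rpred_horner => //; apply: (polyOverSv (sub1v _)); exact: alg_polyOver.
Qed.

Lemma exists_cubic_adjunction (K : fieldType) (iota : {rmorphism K -> algC})
    (z a : K) (al : algC) : 3.-primitive_root z -> al ^+ 3 = iota a ->
    ~ image_of iota al ->
  exists (L : fieldExtType K) (e : {rmorphism L -> algC}) (rt : L),
    [/\ forall c : K, e c%:A = iota c, \dim {:L} = 3, e rt = al &
        forall x, exists q, x = (map_poly (in_alg L) q).[rt]].
Proof.
move=> zP alE alK.
pose p : {poly K} := 'X^3 - a%:P.
have sp : size p = 4 by rewrite size_XnsubC.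
have pz0 : root (map_poly iota p) al.
  by rewrite rootE rmorphB /= map_polyXn map_polyC /= hornerD hornerN hornerXn
    hornerC alE subrr.
have irr_p : irreducible_poly p.
  apply: cubic_irreducible; rewrite ?sp // => x; apply/negP => /rootP px.
  have xa : x ^+ 3 = a.
    by apply/eqP; rewrite -subr_eq0 -px hornerD hornerN hornerXn hornerC.
  have [x0|x0] := eqVneq x 0.
    apply: alK; exists 0; rewrite rmorph0; apply/eqP.
    by have /eqP := alE; rewrite -xa x0 expr0n rmorph0 expf_eq0.
  have ix0 : iota x != 0 by rewrite fmorph_eq0.
  have izP : 3.-primitive_root (iota z) by rewrite fmorph_primitive_root.
  have /(prim_rootP izP)[i ei] : (al / iota x) ^+ 3 = 1.
    by rewrite expr_div_n alE -xa rmorphXn divff // expf_neq0.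
  by apply: alK; exists (z ^+ i * x); rewrite rmorphM rmorphXn -ei divfK.
have p0 : p != 0 by rewrite -size_poly_gt0 sp.
exists (SubFieldExtType pz0 irr_p), (@subfx_inj _ _ iota al p), (subfx_root iota al p).
split.
- by move=> c; apply: subfx_inj_base.
- by rewrite dimvf -[dim _]/((size p).-1) sp.
- exact: subfx_inj_root.
by move=> x; have [q ->] := subfxEroot pz0 p0 x; exists q.
Qed.

Lemma exists_cubic_extension (K : fieldType) (iota : {rmorphism K -> algC})
    (z a : K) (al : algC) : 3.-primitive_root z -> al ^+ 3 = iota a ->
    ~ image_of iota al ->
  exists (L : splittingFieldType K) (e : {rmorphism L -> algC}),
    [/\ forall c : K, e c%:A = iota c, is_C3_extension L, image_of e al &
        forall x, exists c0 c1 c2 : K,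
          e x = iota c0 + iota c1 * al + iota c2 * al ^+ 2].
Proof.
move=> zP alE alK.
have [L0 [e0 [rt [e0A dimL e0rt gen]]]] := exists_cubic_adjunction zP alE alK.
have rt3 : rt ^+ 3 = a%:A by apply: (fmorph_inj e0); rewrite rmorphXn e0rt e0A alE.
have rt0 : rt != 0.
  by apply/eqP => rt0; apply: alK; exists 0; rewrite rmorph0 -e0rt rt0 rmorph0.
have [p [over1 sep split]] := cube_polynomial_splits zP rt3 rt0 gen.
pose L : splittingFieldType K := HB.pack (GRing.Field.sort L0)
  (FieldExt_isSplittingField.Build K L0 (ex_intro2 _ _ p over1 split)).
exists L, e0; split=> //.
- have gal : galois 1 {:L} by apply/splitting_galoisField; exists p.
  have card : #|'Gal({:L} / 1)%g| = 3.
    by rewrite -galois_dim // dimv1 divn1 -[RHS]dimL.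
  by split=> //; apply: prime_cyclic; rewrite card.
- by exists rt.
move=> x; have [q ->] := gen x; elim/poly_ind: q => [|q c [c0 [c1 [c2 IH]]]].
  by exists 0, 0, 0; rewrite rmorph0 horner0 !rmorph0; ring.
exists (c + a * c2), c0, c1.
rewrite rmorphD rmorphM /= map_polyX map_polyC hornerMXaddC rmorphD rmorphM /= IH.
by rewrite e0A e0rt rmorphD rmorphM -alE; ring.
Qed.

(** * Ranks and integrality *)

(** If the rank of E is infinite, E' has independent families of every length, so its rank is
    infinite too. *)
Lemma ec_rank_add2 (F F' : fieldType) (E : weierstrass F) (E' : weierstrass F') :
  (forall n, has_independent E n -> has_independent E' (n + 2)) ->
  (ec_rank E + 2%:E <= ec_rank E')%E.
Proof.
move=> ext; have ge := @ec_rank_geP _ E.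
case: (pselect (exists r : nat, forall n, has_independent E n <-> (n <= r)%N)) =>
  [h|nh].
  have rE : ec_rank E = (Posz (sval (cid h)))%:E.
    rewrite /ec_rank; case: pselect => // h'; congr ((Posz (sval (cid _)))%:E).
    exact: Prop_irrelevance.
  have /ge/ext/ec_rank_geP : ((Posz (sval (cid h)))%:E <= ec_rank E)%E by rewrite rE.
  by rewrite PoszD EFinD rE.
have rE : ec_rank E = +oo%E by rewrite /ec_rank; case: pselect.
have -> : ec_rank E' = +oo%E; last by rewrite leey.
rewrite /ec_rank; case: pselect => // - [r hr].
have : has_independent E' (r + 2) by apply/ext/ge; rewrite rE leey.
by move/hr; rewrite -{2}[r]addn0 leq_add2l.
Qed.

Lemma discriminant_base_change (F F' : fieldType) (f : {rmorphism F ->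
  F'}) (E : weierstrass F) :
  discriminant (base_change f E) = f (discriminant E).
Proof.
case: E => a1 a2 a3 a4 a6 /=.
by ring.
Qed.

Lemma discriminant_c4_eq0 (E : weierstrass algC) : c4 E = 0 ->
  discriminant E = - 432%:R * mordell_coef E ^+ 2.
Proof.
move=> /c4_a4; case: E => a1 a2 a3 a4 a6 /= ->; rewrite /mordell_coef /=.
by field.
Qed.

Definition image_pred (K : fieldType) (iota : {rmorphism K -> algC}) : {pred algC} :=
  fun x => `[< image_of iota x >].

Section ImageField.
Variables (K : fieldType) (iota : {rmorphism K -> algC}).

Lemma image_predP x : reflect (image_of iota x) (x \in image_pred iota).
Proof. exact: asboolP. Qed.

Fact image_pred_closed : divring_closed (image_pred iota).
Proof.
split; first by apply/image_predP; exists 1; rewrite rmorph1.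
  move=> x y /image_predP[a ->] /image_predP[b ->]; apply/image_predP.
  by exists (a - b); rewrite rmorphB.
move=> x y /image_predP[a ->] /image_predP[b ->]; apply/image_predP.
by exists (a / b); rewrite fmorph_div.
Qed.

HB.instance Definition _ := GRing.isDivringClosed.Build algC (image_pred iota)
  image_pred_closed.

Definition image_field : divringClosed algC := image_pred iota.

Lemma in_image_field x : iota x \in image_field.
Proof. by apply/image_predP; exists x. Qed.

End ImageField.

(** Clearing the denominators of the multiplication matrix of x makes its characteristic polynomial
    monic with integer coefficients. *)
Lemma exists_integral_multiple (K : fieldExtType rat) (iota : {rmorphism K ->
  algC}) (x : K) :
  exists2 m : nat, (0 < m)%N & iota x *+ m \in Aint.
Proof.
have [n [b bP]] := exists_basis K.
pose m := (\prod_i \prod_j `|denq (regmx b x i j)|)%N.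
have m0 : (0 < m)%N.
  by apply: prodn_gt0 => i; apply: prodn_gt0 => j; rewrite absz_gt0 denq_eq0.
exists m => //.
have int_entry i j : exists z : int, regmx b (x *+ m) i j = z%:~R.
  have /dvdnP[q mE] : (`|denq (regmx b x i j)| %| m)%N.
    rewrite /m (bigD1 i) //= (bigD1 j) //= -mulnA; exact: dvdn_mulr.
  exists (q%:Z * numq (regmx b x i j)).
  have -> : regmx b (x *+ m) = regmx b x *+ m.
    by apply/matrixP => i' j'; rewrite mulmxnE !mxE mulrnAl linearMn.
  rewrite mulmxnE intrM numqE mE -mulr_natr natrM mulrCA; congr (_ * (_ * _)).
  by rewrite -{2}[denq _]gez0_abs // ltW // denq_gt0.
have /choice[B BE] ij : exists z : int, regmx b (x *+ m) ij.1 ij.2 = z%:~R by [].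
pose A : 'M[int]_n.+1 := \matrix_(i, j) B (i, j).
have AE : map_mx intr A = regmx b (x *+ m).
  by apply/matrixP => i j; rewrite !mxE -(BE (i, j)) mxE.
have chi0 : (map_poly (in_alg K) (char_poly (regmx b (x *+ m)))).[x *+ m] = 0.
  by apply: (regmx_inj bP); rewrite (regmx_horner bP) Cayley_Hamilton (rmorph0 (regmx
    b)).
apply: (@root_monic_Aint (map_poly intr (char_poly A))).
- rewrite rootE -rmorphMn.
  have -> : map_poly intr (char_poly A) =
      map_poly iota (map_poly (in_alg K) (char_poly (regmx b (x *+ m)))).
    rewrite -AE -map_char_poly -!map_poly_comp; apply: eq_map_poly => z /=.
    by rewrite scaler_int rmorphMz rmorph1.
  by rewrite horner_map chi0 rmorph0.
- by apply: monic_map; apply: char_poly_monic.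
by apply/polyOverP => i; rewrite coef_map; apply: Num.Theory.intr_int.
Qed.

Lemma exists_two_adic_shift (K : fieldExtType rat) (iota : {rmorphism K ->
  algC}) (x : K) :
  exists s : rat, forall t : int, ratr (t%:~R + s) != 0 :> algC /\
    exists2 rho, rho \in Aint2 & iota x / ratr (t%:~R + s) ^+ 2 = 2%:R * rho.
Proof.
have [m m0 xA] := exists_integral_multiple iota x.
have [q q2 mE] := pfactor_coprime (isT : prime 2) m0; set j := logn 2 m in mE.
have n2 : (2%:R : algC) != 0 by rewrite pnatr_eq0.
have [qh qE] : exists qh, q = (1 + 2 * qh)%N.
  exists q./2; rewrite mul2n -{1}[q]odd_double_half; congr (_ + _)%N.
  by move: q2; rewrite coprime2n => ->.
have q0 : (q%:R : algC) != 0 by rewrite qE pnatr_eq0.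
(* 2^j is the 2-part of a denominator of x. The ordinate t + s is a 2-adic unit over 2^(j+1), so
   dividing x by its square leaves a factor 2^(j+2), whatever t is. *)
exists (2%:R ^+ j.+1)^-1 => t.
set h : algC := 2%:R ^+ j.
have h0 : h != 0 by rewrite expf_neq0.
have wA : h * t%:~R \in Aint2 by rewrite Aint_Aint2 // rpredM ?rpredX ?rpred_nat //
  Aint_int.
have [w0 wVA] := odd_Aint2_inv wA.
have yE : ratr (t%:~R + (2%:R ^+ j.+1)^-1) = (1 + 2%:R * (h * t%:~R)) /
  (2%:R * h) :> algC.
  rewrite rmorphD rmorph_int fmorphV rmorphXn rmorph_nat exprS -/h; field.
  by rewrite h0.
split; first by rewrite yE mulf_neq0 // invr_eq0 mulf_neq0.
pose v := iota x *+ m.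
exists (2%:R * h * v * (q%:R)^-1 * (1 + 2%:R * (h * t%:~R))^-1 ^+ 2).
  have qVA : (q%:R : algC)^-1 \in Aint2.
    rewrite qE natrD natrM; apply: (odd_Aint2_inv _).2.
    by rewrite Aint_Aint2 // rpred_nat.
  by rewrite !rpredM ?rpredX ?rpred_nat // Aint_Aint2.
have -> : v = iota x * (q%:R * h) by rewrite /v mE -mulr_natr natrM natrX.
by rewrite yE; field; rewrite h0 q0 w0.
Qed.

(** Each term is chosen from the list [S n] of all earlier values. The default 0 in the choice is
    for lists containing 0, which never occur. *)
Lemma exists_cube_independent_sequence (K : fieldType) (A : int -> K) :
  (forall r : seq K, (forall x, x \in r -> x != 0) -> exists t : int, A t != 0 /\
    forall (c : K) (e : nat -> nat), A t != c ^+ 3 * \prod_(i < size r) r`_i ^+ e i) ->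
  exists t : nat -> int, (forall n, A (t n) != 0) /\
    forall n (c : K) (e : nat -> nat), A (t n) != c ^+ 3 * \prod_(i < n) A (t i) ^+ e i.
Proof.
move=> H; have /choice[F FP] (r : seq K) : exists t : int, (forall x,
  x \in r -> x != 0) ->
    A t != 0 /\ forall (c : K) (e : nat -> nat),
      A t != c ^+ 3 * \prod_(i < size r) r`_i ^+ e i.
  case: (pselect (forall x, x \in r -> x != 0)) => [/H[t ?]|nr]; first by exists t.
  by exists 0.
pose S := fix S n := if n is n'.+1 then rcons (S n') (A (F (S n'))) else [::].
have sizeS n : size (S n) = n by elim: n => //= n IH; rewrite size_rcons IH.
have S0 n x : x \in S n -> x != 0.
  elim: n x => //= n IH x; rewrite mem_rcons inE => /orP[/eqP ->|/IH //].
  by have [] := FP _ IH.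
have nthS n i : (i < n)%N -> (S n)`_i = A (F (S i)).
  elim: n => // n IH; rewrite ltnS leq_eqVlt /= nth_rcons sizeS => /orP[/eqP ->|lt].
    by rewrite ltnn eqxx.
  by rewrite lt IH.
exists (fun n => F (S n)); split=> [n|n c e]; first by have [] := FP _ (S0 n).
have [_ /(_ c e)] := FP _ (S0 n); rewrite sizeS.
by rewrite (eq_bigr (fun i : 'I_n => A (F (S i)) ^+ e i)) // => i _; rewrite nthS.
Qed.

Lemma mordell_map_lift (F : fieldType) (f : {rmorphism F -> algC}) (W : weierstrass F)
    (E : weierstrass algC) (v X Y : F) : base_change f W = E -> v != 0 ->
  exists x y, mordell_map E (f v) (Some (f x, f y)) = Some (f X, f Y).
Proof.
move=> <- v0; have fv0 : f v != 0 by rewrite fmorph_eq0.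
pose x := X / v ^+ 2 - (wa1 W ^+ 2 + 4%:R * wa2 W) / 12%:R.
exists x, (Y / v ^+ 3 - (wa1 W * x + wa3 W) / 2%:R); rewrite /mordell_map /=.
have fx : f x = f X / f v ^+ 2 - (f (wa1 W) ^+ 2 + 4%:R * f (wa2 W)) / 12%:R.
  by rewrite /x rmorphB !fmorph_div rmorphD !rmorphXn rmorphM !rmorph_nat.
clearbody x; rewrite rmorphB !fmorph_div rmorphD rmorphXn rmorphM rmorph_nat fx.
by congr (Some (_, _)); field.
Qed.

Lemma mordell_coef_base_change (F : fieldType) (f : {rmorphism F ->
  algC}) (W : weierstrass F) :
  mordell_coef (base_change f W) = f (mordell_coef W).
Proof.
rewrite /mordell_coef /= rmorphB !fmorph_div !rmorph_nat; congr (_ / _ - _ / _); ring.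
Qed.

Theorem theorem6p3 (K : fieldExtType rat) (iota : {rmorphism K -> algC})
    (zeta : K) (E : weierstrass K) :
  3.-primitive_root zeta ->
  elliptic E ->
  has_CM_by (base_change iota E) (Z_adjoin zeta) ->
  exists (L : nat -> splittingFieldType K)
         (e : forall i, {rmorphism L i -> algC}),
    [/\ forall i (a : K), e i (a%:A) = iota a,
        forall i, is_C3_extension (L i),
        linearly_disjoint_seq (image_of iota) (fun i => image_of (e i)) &
        forall i, (ec_rank E + 2%:E
                   <= ec_rank (base_change (in_alg (L i)) E))%E].
Proof.
move=> zP ell cm; have c4E := CM_c4_eq0 zP cm.
set EC := base_change iota E in c4E.
have EE : base_change iota E = EC by [].
pose dE := mordell_coef E.
have dEC : mordell_coef EC = iota dE by apply: mordell_coef_base_change.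
have dE0 : dE != 0.
  apply: contraNneq ell => dE0.
  by rewrite -(fmorph_eq0 iota) -discriminant_base_change discriminant_c4_eq0 // dEC
    dE0 rmorph0 expr0n mulr0.
have [n [b bP]] := exists_basis K.
have [u u0 sep] := exists_separable_twist bP dE0.
pose d := dE * u ^+ 6.
have d0 : d != 0 by rewrite mulf_neq0 ?expf_neq0.
have iu0 : iota u != 0 by rewrite fmorph_eq0.
have D0 : iota d != 0 by rewrite fmorph_eq0.
have DE : iota d = iota u ^+ 6 * mordell_coef EC by rewrite dEC rmorphM rmorphXn mulrC.
have [s sP] := exists_two_adic_shift iota d.
pose A (t : int) : K := ((t%:~R + s) ^+ 2)%:A - d.
have [t [t0 tind]] := @exists_cube_independent_sequence K A
  (fun r r0 => exists_new_cube_class bP s d0 sep r0).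
pose al i : algC := 3.-root (iota (A (t i))).
have alE i : al i ^+ 3 = iota (A (t i)) by rewrite rootCK.
(* With all exponents 0, [tind] says that A (t i) is not a cube in K. *)
have alk i : ~ image_of iota (al i).
  move=> [c ec]; have /eqP := tind i c (fun=> 0%N); apply.
  rewrite big1 ?mulr1 //; apply: (fmorph_inj iota); rewrite -alE ec rmorphXn //.
have [izs iz3] : 1 + iota zeta + iota zeta ^+ 2 = 0 /\ iota zeta ^+ 3 = 1.
  by apply: prim3_sum; rewrite fmorph_primitive_root.
have /choice[Le LeP] i : exists Le : {L : splittingFieldType K & {rmorphism L -> algC}},
    [/\ forall c : K, projT2 Le c%:A = iota c, is_C3_extension (projT1 Le),
        image_of (projT2 Le) (al i) &
        forall x, exists c0 c1 c2 : K,
          projT2 Le x = iota c0 + iota c1 * al i + iota c2 * al i ^+ 2].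
  have [L [e h]] := exists_cubic_extension zP (alE i) (@alk i).
  by exists (existT _ L e).
exists (fun i => projT1 (Le i)), (fun i => projT2 (Le i)); split.
- by move=> i; case: (LeP i).
- by move=> i; case: (LeP i).
- apply: (@tower_linearly_disjoint _ (image_field iota) (fun i =>
  iota (A (t i))) al (iota zeta)) => //.
  + by move=> i; apply: in_image_field.
  + by move=> i; rewrite fmorph_eq0.
  + exact: in_image_field.
  + by rewrite fmorph_primitive_root.
  + by move=> x; split=> [?|/image_predP //]; apply/image_predP.
  + move=> i x [l ->]; have [_ _ _ /(_ l)[c0 [c1 [c2 ->]]]] := LeP i.
    by apply/cubic_spanP; exists (iota c0, iota c1, iota c2);
      rewrite /= !in_image_field.
  move=> m _ e /image_predP[c ->].
  have -> : iota c ^+ 3 * \prod_(i < m) iota (A (t i)) ^+ e i =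
      iota (c ^+ 3 * \prod_(i < m) A (t i) ^+ e i).
    by rewrite rmorphM rmorphXn rmorph_prod; congr (_ * _); apply: eq_bigr => i _;
      rewrite rmorphXn.
  by rewrite fmorph_eq.
move=> i; apply: ec_rank_add2 => m [P Pind].
case: (Le i) (LeP i) => L e /= [eA _ [rt ert] _].
set EL := base_change _ E.
have ELE : base_change e EL = EC.
  by rewrite /EL /EC /base_change /=; congr Weierstrass; apply: eA.
(* Both maps have the same target, so a point of E(K) and its image in E(L) become literally
   equal. *)
pose mapK := point_map D0 EE c4E iu0 DE; pose mapL := point_map D0 ELE c4E iu0 DE.
pose Q j := mapK (P j).
have Qind := (z_independent_point_map D0 EE c4E iu0 DE P).1 Pind.
pose yK : K := ((t i)%:~R + s)%:A.
have yE : iota yK = ratr ((t i)%:~R + s) by apply: (fmorph_eq_rat (iota \o in_alg K)).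
have [y0 rho] := sP (t i); rewrite -yE in y0 rho.
have on : on_curve (mordell (iota d)) (Some (al i, iota yK)).
  rewrite on_mordellE alE -rmorphD /A subrK -rmorphXn; apply/eqP; congr (iota _).
  by rewrite /yK -[RHS]/(in_alg K _) -[_%:A]/(in_alg K _) -rmorphXn.
pose PP : mpoint D0 := exist (on_curve (mordell (iota d))) _ on.
have PPv : val PP = Some (al i, iota yK) by [].
have free := mordell_nontorsion PPv y0 rho.
pose PP' := rotate iz3 PP.
have PPv' : val PP' = Some (iota zeta * al i, iota yK) by [].
have Qk j : Q j \in twisted (image_field iota) 1.
  case eP: (val (P j)) => [[x y]|]; last first.
    by rewrite /twisted unfold_in val_point_map eP.
  have eQ : val (Q j) = Some (iota u ^+ 2 * (iota x + (wa1 EC ^+ 2 + 4%:R * wa2 EC) /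
    12%:R),
       iota u ^+ 3 * (iota y + (wa1 EC * iota x + wa3 EC) / 2%:R)).
    by rewrite val_point_map eP.
  rewrite (twistedP _ _ eQ) divr1 /EC /=.
  by rewrite ?(in_image_field, rpred_nat, rpredX, rpred_div, rpredM, rpredD).
have /choice[R RP] j : exists R : ecpoint EL, mapL R = Q j.
  case eP: (val (P j)) => [[x y]|].
    apply: (@point_map_surj _ _ _ _ _ _ D0 ELE c4E iu0 DE _ (in_alg L x) (in_alg L y)).
    by rewrite val_point_map eP /= !eA.
  by exists (ec0 EL); apply: val_inj; rewrite !val_point_map eP.
(* The inverse change of coordinates is defined over L because u comes from K. *)
have lift X Y (Z : mpoint D0) : val Z = Some (e X, e Y) -> exists S, mapL S = Z.
  move=> eZ; have uL0 : in_alg L u != 0 by rewrite fmorph_eq0.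
  have [x [y]] := mordell_map_lift X Y ELE uL0; rewrite [e (in_alg L u)]eA => exy.
  by apply: (@point_map_surj _ _ _ _ _ _ D0 ELE c4E iu0 DE _ x y); rewrite exy.
have [S SE] : exists S, mapL S = PP.
  by apply: (@lift rt (in_alg L yK)); rewrite PPv -ert [e (in_alg L yK)]eA.
have [S' SE'] : exists S, mapL S = PP'.
  apply: (@lift (in_alg L zeta * rt) (in_alg L yK)).
  by rewrite PPv' rmorphM -ert [e (in_alg L yK)]eA [e (in_alg L zeta)]eA.
(* The two additional points are P and zeta P. *)
exists (fun j : 'I_(m + 2) => match split j with
  | inl l => R l | inr l => if l == ord0 then S else S' end).
apply/(z_independent_point_map D0 ELE c4E iu0 DE) => c.
rewrite big_split_ord /= !big_ord_recl big_ord0 addr0.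
have sl l : split (lshift 2 l) = inl l :> 'I_m + 'I_2 by rewrite (unsplitK (inl l)).
have sr l : split (rshift m l) = inr l :> 'I_m + 'I_2 by rewrite (unsplitK (inr l)).
rewrite !sr /=; under eq_bigr => l _ do rewrite sl.
rewrite -/mapL SE SE'; under eq_bigr => l _ do rewrite RP.
have alk' : al i \notin image_field iota by apply/negP => /image_predP /alk.
case/(twisted_independent izs (in_image_field _ _) (alE i) (in_image_field _ _) alk'
  (in_image_field _ _) PPv free Qk Qind) => c0 p0 q0 j.
case: (split_ordP j) => l ->; first exact: c0.
case: l => [[|[|//]] hl]; [rewrite -[RHS]p0 | rewrite -[RHS]q0];
  congr (c (rshift m _)); exact: val_inj.
Qed.
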